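(* Let $K$ be a field, $G$ a group, $n>0$ a fixed integer and $H$ a fixed subgroup of $G$. The maps $\pi\mapsto\alpha^\pi$ and $\alpha\mapsto\pi_\alpha$ establish a one-to-one correspondence (that is, induce mutually inverse bijections) between the equivalence classes of the elementary partial representations $\pi:G\to M_n(KH)$ and the equivalence classes of the partial actions $\alpha$ of $G$ on $K^n$ with $\mathrm{St}(A_1(\alpha))=H$ and $(A_1(\alpha):H)=n$.
   Context: **Partial actions.** Algebras are associative $K$-algebras. A partial action $\alpha$ of $G$ on an algebra $\mathcal{A}$ is a collection of two-sided ideals $\mathcal{D}_g$ of $\mathcal{A}$ and algebra isomorphisms $\alpha_g:\mathcal{D}_{g^{-1}}\to\mathcal{D}_g$ $(g\in G)$ such that $\mathcal{D}_1=\mathcal{A}$, $\alpha_1=\mathrm{id}$; $\mathcal{D}_{(gh)^{-1}}\supseteq\alpha_h^{-1}(\mathcal{D}_h\cap\mathcal{D}_{g^{-1}})$; and $\alpha_g\circ\alpha_h(x)=\alpha_{gh}(x)$ for $x\in\alpha_h^{-1}(\mathcal{D}_h\cap\mathcal{D}_{g^{-1}})$. Partial actions $\alpha$ on $\mathcal{A}$ and $\alpha'$ on $\mathcal{A}'$ (with ideals $\mathcal{D}_g$, $\mathcal{D}'_g$) are equivalent if there is an algebra isomorphism $\varphi:\mathcal{A}\to\mathcal{A}'$ with $\varphi(\mathcal{D}_g)=\mathcal{D}'_g$ and $\alpha'_g\circ\varphi=\varphi\circ\alpha_g$ on $\mathcal{D}_{g^{-1}}$ for all $g$. The skew group ring $\mathcal{A}\rtimes_\alpha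 G$ is the set of finite formal sums $\sum_g a_g\delta_g$, $a_g\in\mathcal{D}_g$, with the obvious addition and multiplication determined by $(a_g\delta_g)(b_h\delta_h)=\alpha_g(\alpha_{g^{-1}}(a_g)b_h)\delta_{gh}$. **Partial representations.** A partial representation of $G$ into a unital $K$-algebra $\mathcal{B}$ is a map $\pi:G\to\mathcal{B}$ with $\pi(1)=1$ and, for all $g,h\in G$, $\pi(g)\pi(h)\pi(h^{-1})=\pi(gh)\pi(h^{-1})$ and $\pi(g^{-1})\pi(g)\pi(h)=\pi(g^{-1})\pi(gh)$. Partial representations $\pi:G\to\mathcal{B}$, $\pi':G\to\mathcal{B}'$ are equivalent if there is an algebra isomorphism $\varphi:\mathcal{B}'\to\mathcal{B}$ with $\pi(g)=\varphi(\pi'(g))$ for all $g\in G$. **The map $\alpha\mapsto\pi_\alpha$.** If every $\mathcal{D}_g$ is an algebra with unity $1_g$ (possibly $1_g=0$), then $\pi_\alpha:G\to\mathcal{A}\rtimes_\alpha G$, $\pi_\alpha(g)=1_g\delta_g$, is a partial representation. **The map $\pi\mapsto\alpha^\pi$.** For a partial representation $\pi:G\to\mathcal{B}$, the elements $\varepsilon_g=\pi(g)\pi(g^{-1})$ are commuting idempotents. Let $\mathcal{A}$ be the subalgebra of $\mathcal{B}$ they generate and $\mathcal{D}_g=\varepsilon_g\mathcal{A}$. The maps $\alpha^\pi_g:\mathcal{D}_{g^{-1}}\to\mathcal{D}_g$, $\alpha_g^\pi(a)=\pi(g)a\pi(g^{-1})$, form a partial action $\alpha^\pi$ of $G$ on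 $\mathcal{A}$. Both maps preserve equivalence. **Elementary partial representations.** Let $A\subseteq G$ with $1\in A$, let $H=\mathrm{St}(A)=\{h\in G:hA=A\}$ (so $A$ is a union of right cosets $Hg$), and suppose $A$ is the union of a finite number $n=(A:H)$ of such cosets. Left multiplication of $A$ by elements $g$ with $g^{-1}\in A$ gives exactly $n$ distinct sets $A=A_1,A_2,\dots,A_n$, each containing $1$. Let $\Gamma$ be the groupoid with objects $A_1,\dots,A_n$, whose morphisms $A_i\to A_j$ are the pairs $(A_i,g)$ with $g\in G$, $gA_i=A_j$ (so $g^{-1}\in A_i$), with composition $(A_i,g)\circ(A_j,g')=(A_j,gg')$ defined iff $g'A_j=A_i$. Let $K\Gamma$ be the groupoid algebra ($K$-basis the morphisms; products of non-composable morphisms are $0$). For each $i$ fix $g_i\in G$ with $g_iA=A_i$; then $\tau:K\Gamma\to M_n(KH)$, $(A_i,g)\mapsto e_{j,i}(g_j^{-1}gg_i)$ where $gA_i=A_j$, is an algebra isomorphism; here $e_{j,i}(h)$ is the $n\times n$ matrix whose unique non-zero entry is $h\in H$ in position $(j,i)$. The map $\lambda:G\to K\Gamma$, $\lambda(g)=\sum_{A_i\ni g^{-1}}(A_i,g)$ (equal to $0$ if $g^{-1}\notin\bigcup_iA_i$), is a partial representation. The partial representations $\tau\circ\lambda:G\to M_n(KH)$ obtained in this way are called elementary; different choices of the $g_i$ give equivalent partial representations. The equivalence class of an elementary partial representation is the set of all partial representations of $G$ equivalent to it. For elementary $\pi$, the algebra generated by the $\varepsilon_g$ is the diagonal subalgebra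 $\mathrm{diag}(K,\dots,K)\cong K^n$, so $\alpha^\pi$ is viewed as a partial action on $K^n$. **The sets $A_i(\alpha)$.** For a partial action $\alpha$ of $G$ on $K^n\cong\mathrm{diag}(K,\dots,K)$, each $\mathcal{D}_g$ is an algebra with unity $1_g$ (a sum of some minimal idempotents $e_{i,i}(1)$). Put $A_i(\alpha)=\{g\in G:(1_g)_{i,i}\neq0\}$, where $(1_g)_{i,i}$ is the $i$-th diagonal entry of $1_g$. $\mathrm{St}$ and $(A_1(\alpha):H)$ are the stabilizer under left multiplication and the number of right cosets of $H$ in $A_1(\alpha)$. *)

(* Defs.v *)
From HB Require Import structures.
From mathcomp Require Import all_boot all_algebra finmap.
From mathcomp Require Import boolp classical_sets functions cardinality fsbigop.

Set Implicit Arguments.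
Unset Strict Implicit.
Unset Printing Implicit Defensive.

Import GRing.Theory.
Local Open Scope classical_set_scope.
Local Open Scope ring_scope.

(* The K-algebras below are those of the library: associative, unital and
   nonzero. Any algebra isomorphic to K^n or to M_n(KH), n > 0, is of this kind,
   and any isomorphism between such algebras preserves 1. *)
Record partial_rep (K : fieldType) (G : groupType) (B : algType K) :=
  PartialRep {
    prep_fun :> G -> B;
    prep1 : prep_fun 1%g = 1;
    prepMV : forall g h : G,
      prep_fun g * prep_fun h * prep_fun h^-1%g
      = prep_fun (g * h)%g * prep_fun h^-1%g;
    prepVM : forall g h : G,
      prep_fun g^-1%g * prep_fun g * prep_fun h
      = prep_fun g^-1%g * prep_fun (g * h)%g
  }.

Definition prep_equiv (K : fieldType) (G : groupType) (B B' : algType K)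
    (p : partial_rep G B) (p' : partial_rep G B') : Prop :=
  exists2 phi : {lrmorphism B' -> B}, bijective phi
    & forall g, p g = phi (p' g).

Record any_prep (K : fieldType) (G : groupType) := AnyPrep {
  prep_alg : algType K;
  prep_of :> partial_rep G prep_alg
}.

(* The class of p ranges over partial representations into all algebras. *)
Definition prep_class (K : fieldType) (G : groupType) (B : algType K)
    (p : partial_rep G B) :
    any_prep K G -> Prop :=
  fun q => prep_equiv q p.

Section PartialAction.
Variables (K : fieldType) (G : groupType) (A : algType K).

Definition two_sided_ideal (I : set A) : Prop :=
  [/\ I 0,
      forall (k : K) x y, I x -> I y -> I (k *: x + y)
    & forall a x, I x -> I (a * x) /\ I (x * a)].

Definition alg_iso_on (I J : set A) (f : A -> A) : Prop :=
  [/\ set_bij I J f,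
      forall (k : K) x y, I x -> I y -> f (k *: x + y) = k *: f x + f y
    & forall x y, I x -> I y -> f (x * y) = f x * f y].

(* The maps alpha_g : D_(g^-1) -> D_g are represented by total functions on A;
   their values off D_(g^-1) are irrelevant (see [pact_equiv]). *)
Record partial_action := PartialAction {
  pdom : G -> set A;
  pact : G -> A -> A;
  pdom_ideal : forall g, two_sided_ideal (pdom g);
  pact_iso : forall g, alg_iso_on (pdom g^-1%g) (pdom g) (pact g);
  pdom1 : pdom 1%g = [set: A];
  pact1 : forall x, pact 1%g x = x;
  pdom_comp : forall g h,
    pdom h^-1%g `&` pact h @^-1` (pdom h `&` pdom g^-1%g)
    `<=` pdom (g * h)^-1%g;
  pact_comp : forall g h x,
    (pdom h^-1%g `&` pact h @^-1` (pdom h `&` pdom g^-1%g)) x ->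
    pact g (pact h x) = pact (g * h)%g x
}.

Definition is_unity (I : set A) (e : A) : Prop :=
  I e /\ forall x, I x -> e * x = x /\ x * e = x.

Definition unital_pact (al : partial_action) : Prop :=
  forall g, exists e, is_unity (pdom al g) e.

(* 1_g if D_g has a unity, and 0 otherwise *)
Definition pone (al : partial_action) (g : G) : A :=
  xget 0 [set e | is_unity (pdom al g) e].

End PartialAction.
Arguments partial_action {K} G A.

Definition pact_equiv (K : fieldType) (G : groupType) (A A' : algType K)
    (al : partial_action G A) (al' : partial_action G A') : Prop :=
  exists2 phi : {lrmorphism A -> A'}, bijective phi
    & forall g, phi @` pdom al g = pdom al' g /\
        forall x, pdom al g^-1%g x -> pact al' g (phi x) = phi (pact al g x).

Record any_pact (K : fieldType) (G : groupType) := AnyPact {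
  pact_alg : algType K;
  pact_of :> partial_action G pact_alg
}.

Definition pact_class (K : fieldType) (G : groupType) (A : algType K)
    (al : partial_action G A) :
    any_pact K G -> Prop :=
  fun be => pact_equiv be al.

Section PartialActionTheory.
Variables (K : fieldType) (G : groupType) (A : algType K).
Variable al : partial_action G A.
Implicit Types (g h : G) (x y : A).
Local Notation D := (pdom al).
Local Notation act := (pact al).

Lemma pdom0 g : D g 0.
Proof. by have [] := pdom_ideal al g. Qed.

Lemma pdomZD g k x y : D g x -> D g y -> D g (k *: x + y).
Proof. by have [_ + _] := pdom_ideal al g; apply. Qed.

Lemma pdomD g x y : D g x -> D g y -> D g (x + y).
Proof. by move=> Dx Dy; rewrite -[x]scale1r; apply: pdomZD. Qed.

Lemma pdomZ g k x : D g x -> D g (k *: x).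
Proof. by move=> Dx; rewrite -[_ *: _]addr0; apply: pdomZD => //; exact: pdom0. Qed.

Lemma pdomMl g a x : D g x -> D g (a * x).
Proof. by have [_ _ /(_ a x) IM /IM[]] := pdom_ideal al g. Qed.

Lemma pdomMr g a x : D g x -> D g (x * a).
Proof. by have [_ _ /(_ a x) IM /IM[]] := pdom_ideal al g. Qed.

Lemma pdom_sum g I (r : seq I) (P : pred I) F :
  (forall i, P i -> D g (F i)) -> D g (\sum_(i <- r | P i) F i).
Proof. by move=> DF; elim/big_ind: _ => //; [exact: pdom0|exact: pdomD]. Qed.

Lemma pactZD g k x y : D g^-1%g x -> D g^-1%g y ->
  act g (k *: x + y) = k *: act g x + act g y.
Proof. by have [_ + _] := pact_iso al g; apply. Qed.

Lemma pactD g x y : D g^-1%g x -> D g^-1%g y -> act g (x + y) = act g x + act g y.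
Proof. by move=> Dx Dy; rewrite -[x in LHS]scale1r pactZD// scale1r. Qed.

Lemma pact0 g : act g 0 = 0.
Proof.
have := pactD (pdom0 g^-1%g) (pdom0 g^-1%g).
by rewrite addr0 -[X in X = _]addr0 => /addrI.
Qed.

Lemma pactZ g k x : D g^-1%g x -> act g (k *: x) = k *: act g x.
Proof.
by move=> Dx; rewrite -[k *: x]addr0 pactZD ?pact0 ?addr0//; exact: pdom0.
Qed.

Lemma pactM g x y : D g^-1%g x -> D g^-1%g y -> act g (x * y) = act g x * act g y.
Proof. by have [_ _] := pact_iso al g; apply. Qed.

Lemma pact_dom g x : D g^-1%g x -> D g (act g x).
Proof. by have [[fD _ _] _ _] := pact_iso al g; apply: fD. Qed.

Lemma pact_domV g x : D g x -> D g^-1%g (act g^-1%g x).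
Proof. by move=> Dx; apply: pact_dom; rewrite invgK. Qed.

Lemma pact_sum g I (r : seq I) (P : pred I) F :
  (forall i, P i -> D g^-1%g (F i)) ->
  act g (\sum_(i <- r | P i) F i) = \sum_(i <- r | P i) act g (F i).
Proof.
move=> DF; have: D g^-1%g (\sum_(i <- r | P i) F i) /\
    act g (\sum_(i <- r | P i) F i) = \sum_(i <- r | P i) act g (F i).
  elim/big_rec2: _ => [|i y x Pi [Dx IH]]; first by split; [exact: pdom0|exact: pact0].
  by split; [apply: pdomD; auto|rewrite pactD ?IH; auto].
by case.
Qed.

Lemma pactK g x : D g^-1%g x -> act g^-1%g (act g x) = x.
Proof.
move=> Dx; rewrite (@pact_comp _ _ _ al) ?mulVg ?pact1//.
by split=> //; split; rewrite /= ?invgK; exact: pact_dom.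
Qed.

Lemma pactVK g x : D g x -> act g (act g^-1%g x) = x.
Proof. by move=> Dx; rewrite -[g in act g]invgK pactK ?invgK. Qed.

Lemma pact_domI g h x : D g^-1%g x -> D h x -> D (g * h)%g (act g x).
Proof.
move=> Dx Dhx; have := @pdom_comp _ _ _ al h^-1%g g^-1%g (act g x).
rewrite -invgM !invgK; apply; split; first exact: pact_dom.
by rewrite /= pactK.
Qed.

Lemma pact_comp2 g h x : D h^-1%g x -> D (g * h)^-1%g x ->
  act g (act h x) = act (g * h)%g x.
Proof.
move=> Dx Dghx; apply: pact_comp; split=> //; split; first exact: pact_dom.
by have := pact_domI Dx Dghx; rewrite invgM mulgA mulgV mul1g.
Qed.

Section Unital.
Hypothesis u : unital_pact al.

Lemma poneP g : is_unity (D g) (pone al g).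
Proof. by have [e e1] := u g; rewrite /pone; case: xgetP => [//|/(_ e)]. Qed.

Lemma pone_dom g : D g (pone al g).
Proof. by case: (poneP g). Qed.

Lemma pone_mull g x : D g x -> pone al g * x = x.
Proof. by case: (poneP g) => _ /[apply] -[]. Qed.

Lemma pone_mulr g x : D g x -> x * pone al g = x.
Proof. by case: (poneP g) => _ /[apply] -[]. Qed.

Lemma pone1 : pone al 1%g = 1.
Proof. by rewrite -[LHS]mulr1 pone_mull// pdom1. Qed.

Lemma pact_pone g : act g (pone al g^-1%g) = pone al g.
Proof.
have Dg := pone_dom g; have Dg' := pone_dom g^-1%g; have Dv := pact_domV Dg.
rewrite -[LHS](pone_mulr (pact_dom Dg')).
by rewrite -[X in _ * X](pactVK Dg) -pactM// pone_mull// pactVK.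
Qed.

Lemma pact_poneM g h :
  act g (pone al g^-1%g * pone al h) = pone al g * pone al (g * h)%g.
Proof.
set x := _ * _; have Dgx : D g^-1%g x by apply: pdomMr; exact: pone_dom.
have Dhx : D h x by apply: pdomMl; exact: pone_dom.
have Dax := pact_dom Dgx; have Dghax := pact_domI Dgx Dhx.
set z := _ * pone al (g * h)%g.
have Dgz : D g z by apply: pdomMr; exact: pone_dom.
have Dghz : D (g * h)%g z by apply: pdomMl; exact: pone_dom.
transitivity (act g x * z).
  by rewrite mulrA !pone_mulr.
have Dw : D g^-1%g (act g^-1%g z) by exact: pact_domV.
have Dhw : D h (act g^-1%g z).
  have := @pact_domI g^-1%g (g * h)%g z.
  by rewrite invgK mulgA mulVg mul1g; apply.
rewrite -{1}(pactVK Dgz) -pactM// -mulrA [pone al h * _]pone_mull//.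
by rewrite pone_mull// pactVK.
Qed.

(* The identity behind associativity of the skew group ring. *)
Lemma skew_mulA_term g h a b c : D g a -> D h b ->
  act (g * h)%g (act (g * h)^-1%g (act g (act g^-1%g a * b)) * c)
  = act g (act g^-1%g a * act h (act h^-1%g b * c)).
Proof.
move=> Da Db; set a' := act g^-1%g a.
have Da' : D g^-1%g a' by exact: pact_domV.
have Dab : D g^-1%g (a' * b) by exact: pdomMr.
have Dabh : D h (a' * b) by exact: pdomMl.
set x := act h^-1%g (a' * b).
have Dx : D h^-1%g x by exact: pact_domV.
have Dx' : D (g * h)^-1%g x.
  by rewrite invgM /x; apply: pact_domI => //; rewrite invgK.
have -> : act (g * h)^-1%g (act g (a' * b)) = x.
  rewrite invgM -pact_comp2 ?pactK//; first by rewrite invgK; exact: pact_dom.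
  by rewrite -invgM invgK; exact: pact_domI.
rewrite -pact_comp2; [|exact: pdomMr|exact: pdomMr]; congr (act g _).
have Dbh : D h^-1%g (act h^-1%g b) by exact: pact_domV.
have D1 : D h (a' * pone al h) by apply: pdomMl; exact: pone_dom.
have -> : x = act h^-1%g (a' * pone al h) * act h^-1%g b.
  by rewrite -pactM ?invgK// -mulrA pone_mull.
rewrite -mulrA pactM ?pactVK -?mulrA ?pone_mull//.
- by apply: pact_dom; exact: pdomMr.
- exact: pact_domV.
- exact: pdomMr.
Qed.

End Unital.
End PartialActionTheory.

Lemma unital_pact_equiv (K : fieldType) (G : groupType) (A A' : algType K)
    (al : partial_action G A) (al' : partial_action G A') :
  pact_equiv al al' -> unital_pact al' -> unital_pact al.
Proof.
move=> [phi phi_bij phiE] u g; have [e [De eP]] := u g.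
have [phiD _] := phiE g; have phi_inj := bij_inj phi_bij.
move: De; rewrite -phiD => -[e0 De0 e0E]; exists e0; split=> // x Dx.
have /eP[ex xe] : pdom al' g (phi x) by rewrite -phiD; exists x.
by split; apply: phi_inj; rewrite rmorphM /= e0E.
Qed.

Section SkewGroupRing.
Variables (K : fieldType) (G : groupType) (A : algType K).
Variable al : partial_action G A.
Implicit Types (f : G -> A) (g h k : G).
Local Notation D := (pdom al).
Local Notation act := (pact al).

(* A finite formal sum of terms a_g delta_g is encoded by its coefficient
   function g |-> a_g. *)
Definition skew_pred : {pred G -> A} := fun f =>
  `[< finite_set [set g | f g != 0] /\ forall g, D g (f g) >].

Definition skew_mul f1 f2 : G -> A := fun k =>
  \sum_(g \in [set: G]) act g (act g^-1%g (f1 g) * f2 (g^-1 * k)%g).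

Definition skew_mono (a : A) (g : G) : G -> A := fun h => if h == g then a else 0.

Lemma skew_predP f :
  reflect (finite_set [set g | f g != 0] /\ forall g, D g (f g)) (f \in skew_pred).
Proof. exact: asboolP. Qed.

Lemma skew_fset f : f \in skew_pred ->
  exists F : {fset G}, forall g, g \notin F -> f g = 0.
Proof.
move=> /skew_predP[fin _]; exists (fset_set [set g | f g != 0]) => g.
by rewrite in_fset_set// notin_setE /= => /negP; rewrite negbK => /eqP.
Qed.

Lemma skew_dom f g : f \in skew_pred -> D g (f g).
Proof. by move=> /skew_predP[_]; apply. Qed.

Lemma skew_submod : GRing.submod_closed skew_pred.
Proof.
split=> [|a f1 f2 /skew_predP[fin1 D1] /skew_predP[fin2 D2]]; apply/skew_predP.
  split=> [|g]; last exact: pdom0.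
  by rewrite (_ : [set _ | _] = set0)// -subset0 => g /=; rewrite eqxx.
split=> [|g]; last by apply: pdomZD.
apply: (@sub_finite_set _ _ ([set g | f1 g != 0] `|` [set g | f2 g != 0])).
  move=> g /= /eqP fg; have [f1g0|] := eqVneq (f1 g) 0; last by left.
  right; apply/eqP => f2g0; apply: fg.
  by rewrite /GRing.add /= /GRing.scale /= f1g0 f2g0 scaler0 addr0.
by rewrite finite_setU.
Qed.

Lemma skew_mulE (F : {fset G}) f1 f2 k : (forall g, g \notin F -> f1 g = 0) ->
  skew_mul f1 f2 k = \sum_(g <- F) act g (act g^-1%g (f1 g) * f2 (g^-1 * k)%g).
Proof.
by move=> F0; apply: fsbigTE => g /F0 ->; rewrite pact0 mul0r pact0.
Qed.

Lemma skew_term_dom f1 f2 g k : f1 \in skew_pred -> f2 \in skew_pred ->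
  D k (act g (act g^-1%g (f1 g) * f2 (g^-1 * k)%g)).
Proof.
move=> f1P f2P; rewrite -[k in D k](mulVKg g); apply: pact_domI.
  by apply: pdomMr; apply: pact_domV; exact: skew_dom.
by apply: pdomMl; exact: skew_dom.
Qed.

Lemma skew_mul_pred f1 f2 :
  f1 \in skew_pred -> f2 \in skew_pred -> skew_mul f1 f2 \in skew_pred.
Proof.
move=> f1P f2P; have [F1 F1P] := skew_fset f1P; have [F2 F2P] := skew_fset f2P.
apply/skew_predP; split=> [|k].
  apply: (@sub_finite_set _ _ [set` [fset (g * h)%g | g in F1, h in F2]%fset]) => //.
  move=> k /= /negP k0; apply: contrapT => /negP kN; apply: k0; apply/eqP.
  rewrite (skew_mulE _ _ F1P) big_seq big1// => g gF1.
  rewrite F2P ?mulr0 ?pact0//; apply: contra kN => hF2; apply/imfset2P.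
  by exists g => //; exists (g^-1 * k)%g; rewrite ?mulVKg.
by rewrite (skew_mulE _ _ F1P); apply: pdom_sum => g _; exact: skew_term_dom.
Qed.

Lemma skew_mono_pred a g : D g a -> skew_mono a g \in skew_pred.
Proof.
move=> Da; apply/skew_predP; split=> [|h]; rewrite /skew_mono.
  apply: (@sub_finite_set _ _ [set g]) => //.
  by move=> h /=; have [->//|_] := eqVneq h g; rewrite eqxx.
by case: eqP => [->|_]; [|exact: pdom0].
Qed.

Lemma skew_mul_monol a g f k :
  skew_mul (skew_mono a g) f k = act g (act g^-1%g a * f (g^-1 * k)%g).
Proof.
rewrite (@skew_mulE [fset g]%fset) => [|h]; last first.
  by rewrite in_fset1 /skew_mono => /negbTE ->.
by rewrite big_seq_fset1 /skew_mono eqxx.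
Qed.

Lemma skew_mul_mono a g b h :
  skew_mul (skew_mono a g) (skew_mono b h)
  = skew_mono (act g (act g^-1%g a * b)) (g * h)%g.
Proof.
apply/funext => k; rewrite skew_mul_monol /skew_mono.
have -> : ((g^-1 * k)%g == h) = (k == (g * h)%g).
  by apply/eqP/eqP => [<-|->]; rewrite ?mulVKg ?mulKg.
by case: eqP => //; rewrite mulr0 pact0.
Qed.

Record skew_ring (u : unital_pact al) := SkewRing {
  skew_val : G -> A;
  skew_valP : skew_val \in skew_pred
}.

End SkewGroupRing.

Section SkewGroupRingAlg.
Variables (K : fieldType) (G : groupType) (A : algType K).
Variables (al : partial_action G A) (u : unital_pact al).
Local Notation D := (pdom al).
Local Notation act := (pact al).
Local Notation S := (skew_ring u).

HB.instance Definition _ := [isSub of S for @skew_val K G A al u].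
HB.instance Definition _ := [Choice of S by <:].
HB.instance Definition _ :=
  GRing.SubChoice_isSubLmodule.Build K (G -> A) (skew_pred al) S
    (@skew_submod K G A al).

Definition skew_one : S := SkewRing u (skew_mono_pred (pone_dom u 1%g)).
Definition skew_rmul (x y : S) : S :=
  SkewRing u (skew_mul_pred (valP x) (valP y)).

Lemma skew_mulrA : associative skew_rmul.
Proof.
move=> x y z; apply/esym/val_inj/funext => k /=.
case: x y z => [f1 f1P] [f2 f2P] [f3 f3P] /=.
have [F1 F1P] := skew_fset f1P; have [F2 F2P] := skew_fset f2P.
pose X g v := act v (act v^-1%g (act g (act g^-1%g (f1 g) * f2 (g^-1 * v)%g))
                     * f3 (v^-1 * k)%g).
pose F := [fset (g * h)%g | g in F1, h in F2]%fset.
have X0 g v : g \in F1 -> v \notin F -> X g v = 0.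
  move=> gF1 vN; rewrite /X F2P ?mulr0 ?pact0 ?mul0r ?pact0//.
  apply: contra vN => hF2; apply/imfset2P.
  by exists g => //; exists (g^-1 * v)%g; rewrite ?mulVKg.
have FP v : v \notin F -> skew_mul al f1 f2 v = 0.
  move=> vN; rewrite (skew_mulE _ _ _ F1P) big_seq big1// => g gF1.
  rewrite F2P ?mulr0 ?pact0//; apply: contra vN => hF2; apply/imfset2P.
  by exists g => //; exists (g^-1 * v)%g; rewrite ?mulVKg.
rewrite (skew_mulE _ _ _ FP).
transitivity (\sum_(v <- F) \sum_(g <- F1) X g v).
  apply: eq_bigr => v _; rewrite (skew_mulE _ _ _ F1P).
  have Dt g : D v (act g (act g^-1%g (f1 g) * f2 (g^-1 * v)%g)).
    exact: skew_term_dom.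
  rewrite pact_sum; last by move=> g _; rewrite invgK.
  rewrite mulr_suml pact_sum// => g _.
  by apply: pdomMr; exact: pact_domV.
rewrite exchange_big (skew_mulE _ _ _ F1P) /= big_seq [RHS]big_seq.
apply: eq_bigr => g gF1.
have -> : \sum_(v <- F) X g v = \sum_(v \in [set: G]) X g v.
  by apply/esym/fsbigTE => v; exact: X0.
rewrite (reindex_fsbigT (fun h : G => (g * h)%g)); last first.
  by exists (fun h => (g^-1 * h)%g) => h; rewrite ?mulKg ?mulVKg.
rewrite (fsbigTE F2); last first.
  by move=> h hN; rewrite /X mulKg F2P// mulr0 pact0 pact0 mul0r pact0.
rewrite (skew_mulE _ _ _ F2P) mulr_sumr pact_sum.
  apply: eq_bigr => h _; rewrite /X mulKg invgM -mulgA -invgM.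
  by rewrite (skew_mulA_term u)//; exact: skew_dom.
move=> h _; apply: pdomMr; apply: pact_domV; exact: skew_dom.
Qed.

Lemma skew_mul1r : left_id skew_one skew_rmul.
Proof.
move=> [f fP]; apply/val_inj/funext => k /=.
by rewrite skew_mul_monol invg1 !pact1 mul1g pone1// mul1r.
Qed.

Lemma skew_mulr1 : right_id skew_one skew_rmul.
Proof.
move=> [f fP]; apply/val_inj/funext => k /=.
have [F FP] := skew_fset fP; rewrite (skew_mulE _ _ _ FP).
transitivity (\sum_(g <- F) if g == k then f k else 0).
  apply: eq_bigr => g _; rewrite /skew_mono.
  have -> : ((g^-1 * k)%g == 1%g) = (g == k).
    by apply/eqP/eqP => [/(canRL (mulVKg g))|->]; rewrite ?mulg1 ?mulVg.
  case: eqP => [->|_]; last by rewrite mulr0 pact0.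
  by rewrite pone1// mulr1 pactVK//; exact: skew_dom.
have [kF|kN] := boolP (k \in F).
  by rewrite (big_fsetD1 k)//= eqxx big_seq big1 ?addr0// => g; rewrite in_fsetD1 => /andP[/negbTE ->].
by rewrite big_seq big1 ?FP// => g gF; case: eqP => // _; exact: FP.
Qed.

Lemma skew_mulrDl : left_distributive skew_rmul +%R.
Proof.
move=> [f1 f1P] [f2 f2P] [f3 f3P]; apply/val_inj/funext => k /=.
have [F1 F1P] := skew_fset f1P; have [F2 F2P] := skew_fset f2P.
have H1 g : g \notin (F1 `|` F2)%fset -> f1 g = 0.
  by rewrite in_fsetU negb_or => /andP[/F1P].
have H2 g : g \notin (F1 `|` F2)%fset -> f2 g = 0.
  by rewrite in_fsetU negb_or => /andP[_ /F2P].
have H3 g : g \notin (F1 `|` F2)%fset -> (f1 + f2) g = 0.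
  by move=> gN; rewrite addrfctE H1// H2// addr0.
rewrite (skew_mulE _ _ _ H3).
rewrite !addrfctE (skew_mulE _ _ _ H1) (skew_mulE _ _ _ H2) -big_split.
apply: eq_bigr => g _ /=.
have D1 := skew_dom g f1P; have D2 := skew_dom g f2P.
rewrite pactD ?invgK// mulrDl pactD//; apply: pdomMr; exact: pact_domV.
Qed.

Lemma skew_mulrDr : right_distributive skew_rmul +%R.
Proof.
move=> [f1 f1P] [f2 f2P] [f3 f3P]; apply/val_inj/funext => k /=.
have [F1 F1P] := skew_fset f1P.
rewrite [in RHS]addrfctE !(skew_mulE _ _ _ F1P) -big_split.
apply: eq_bigr => g _ /=; rewrite addrfctE.
have D1 := skew_dom g f1P.
by rewrite mulrDr pactD//; apply: pdomMr; exact: pact_domV.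
Qed.

Lemma skew_one_neq0 : skew_one != 0.
Proof.
apply/eqP => /(congr1 (fun x : S => val x 1%g)) /=.
by rewrite /skew_mono eqxx pone1// => /eqP; rewrite oner_eq0.
Qed.

HB.instance Definition _ := GRing.Zmodule_isNzRing.Build S
  skew_mulrA skew_mul1r skew_mulr1 skew_mulrDl skew_mulrDr skew_one_neq0.

Lemma skew_scalerAl (k : K) (x y : S) : k *: (x * y) = k *: x * y.
Proof.
case: x y => [f1 f1P] [f2 f2P]; apply/val_inj/funext => h /=.
have [F1 F1P] := skew_fset f1P.
have F1P' g : g \notin F1 -> (k *: f1) g = 0.
  by move=> gN; rewrite scalrfctE F1P// scaler0.
rewrite [in LHS]scalrfctE (skew_mulE _ _ _ F1P) (skew_mulE _ _ _ F1P').
rewrite scaler_sumr; apply: eq_bigr => g _; rewrite scalrfctE.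
have D1 := skew_dom g f1P.
rewrite pactZ ?invgK// -scalerAl pactZ//; apply: pdomMr; exact: pact_domV.
Qed.

Lemma skew_scalerAr (k : K) (x y : S) : k *: (x * y) = x * (k *: y).
Proof.
case: x y => [f1 f1P] [f2 f2P]; apply/val_inj/funext => h /=.
have [F1 F1P] := skew_fset f1P.
rewrite [in LHS]scalrfctE !(skew_mulE _ _ _ F1P).
rewrite scaler_sumr; apply: eq_bigr => g _; rewrite scalrfctE.
have D1 := skew_dom g f1P.
by rewrite -scalerAr pactZ//; apply: pdomMr; exact: pact_domV.
Qed.

HB.instance Definition _ :=
  GRing.Lmodule_isLalgebra.Build K S skew_scalerAl.
HB.instance Definition _ :=
  GRing.Lalgebra_isAlgebra.Build K S skew_scalerAr.

Definition pi_fun (g : G) : S := SkewRing u (skew_mono_pred (pone_dom u g)).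

Lemma pi_funM g h :
  val (pi_fun g * pi_fun h) = skew_mono (pone al g * pone al (g * h)%g) (g * h)%g.
Proof.
rewrite /= skew_mul_mono -{1}[g in pone al g]invgK pact_pone// pact_poneM//.
Qed.

Lemma pi_fun1 : pi_fun 1%g = 1.
Proof. by []. Qed.

Lemma pi_funMV g h :
  pi_fun g * pi_fun h * pi_fun h^-1%g = pi_fun (g * h)%g * pi_fun h^-1%g.
Proof.
apply/val_inj; rewrite pi_funM mulgK.
transitivity (skew_mul al (val (pi_fun g * pi_fun h)) (val (pi_fun h^-1%g))) => //.
rewrite pi_funM skew_mul_mono mulgK; congr (skew_mono _ _).
have E : act (g * h)^-1%g (pone al g * pone al (g * h)%g)
    = pone al (g * h)^-1%g * pone al h^-1%g.
  have -> : h^-1%g = ((g * h)^-1 * g)%g by rewrite invgM mulgVK.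
  rewrite -(pact_poneM u (g * h)^-1%g g) invgK; congr (act _ _).
  have Dg := pone_dom u g; have Dgh := pone_dom u (g * h)%g.
  have D1 : D (g * h)%g (pone al (g * h)%g * pone al g) by exact: pdomMr.
  have D2 : D (g * h)%g (pone al g * pone al (g * h)%g) by exact: pdomMl.
  by rewrite -(pone_mull u D2) mulrA (pone_mulr u D1).
rewrite E -mulrA (pone_mulr u (pone_dom u _)).
by rewrite pact_poneM// mulgK.
Qed.

Lemma pi_funVM g h :
  pi_fun g^-1%g * pi_fun g * pi_fun h = pi_fun g^-1%g * pi_fun (g * h)%g.
Proof.
apply/val_inj; rewrite pi_funM mulKg.
transitivity (skew_mul al (val (pi_fun g^-1%g * pi_fun g)) (val (pi_fun h))) => //.
rewrite pi_funM mulVg skew_mul_mono mul1g invg1 !pact1; congr (skew_mono _ _).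
by rewrite pone1// mulr1.
Qed.

Definition prep_of_pact : partial_rep G S := PartialRep pi_fun1 pi_funMV pi_funVM.

End SkewGroupRingAlg.

Section AlphaOf.
Variables (K : fieldType) (G : groupType) (B : algType K).
Variable p : partial_rep G B.
Implicit Types (g h : G) (x y : B).

Definition peps g : B := p g * p g^-1%g.

Definition eps_pred : {pred B} := fun x =>
  `[< forall S : {pred B}, GRing.subalg_closed S ->
        (forall g, peps g \in S) -> x \in S >].

Lemma eps_predP x :
  reflect (forall S : {pred B}, GRing.subalg_closed S ->
    (forall g, peps g \in S) -> x \in S) (x \in eps_pred).
Proof. exact: asboolP. Qed.

Lemma eps_subalg : GRing.subalg_closed eps_pred.
Proof.
split.
- by apply/eps_predP => S [].
- move=> a x y /eps_predP xP /eps_predP yP; apply/eps_predP => S S_alg Seps.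
  by have [_ SL _] := S_alg; apply: SL; [exact: xP|exact: yP].
move=> x y /eps_predP xP /eps_predP yP; apply/eps_predP => S S_alg Seps.
by have [_ _ SM] := S_alg; apply: SM; [exact: xP|exact: yP].
Qed.

Lemma peps_in g : peps g \in eps_pred.
Proof. by apply/eps_predP => S _; apply. Qed.

Lemma eps_ind (P : B -> Prop) : P 1 ->
  (forall (k : K) x y, P x -> P y -> P (k *: x + y)) ->
  (forall x y, P x -> P y -> P (x * y)) ->
  (forall g, P (peps g)) -> forall x, x \in eps_pred -> P x.
Proof.
move=> P1 PL PM Pe x /eps_predP/(_ (fun y => `[< P y >])).
rewrite unfold_in => xP; apply/asboolP; apply: xP => [|g]; last exact/asboolP.
by split=> [|k y z /asboolP ? /asboolP ?|y z /asboolP ? /asboolP ?];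
  apply/asboolP; auto.
Qed.

Lemma prepK g : p g * p g^-1%g * p g = p g.
Proof. by have := prepMV p g g^-1%g; rewrite invgK mulgV prep1 mul1r. Qed.

Lemma peps1 : peps 1%g = 1.
Proof. by rewrite /peps invg1 prep1 mulr1. Qed.

Lemma peps_idem g : peps g * peps g = peps g.
Proof. by rewrite /peps mulrA prepK. Qed.

Lemma prep_eps g h : p g * peps h = peps (g * h)%g * p g.
Proof.
rewrite /peps mulrA prepMV; have := prepVM p (g * h)^-1%g g.
by rewrite invgK => ->; rewrite invgM mulgVK.
Qed.

Lemma peps_comm g h : peps g * peps h = peps h * peps g.
Proof.
rewrite {1}/peps -mulrA prep_eps mulrA prep_eps mulgA mulgV mul1g.
by rewrite -mulrA.
Qed.

Lemma eps_comm g x : x \in eps_pred -> peps g * x = x * peps g.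
Proof.
move: x; apply: eps_ind.
- by rewrite mulr1 mul1r.
- by move=> k x y xE yE; rewrite mulrDr mulrDl -scalerAr xE yE scalerAl.
- by move=> x y xE yE; rewrite mulrA xE -mulrA yE mulrA.
exact: peps_comm.
Qed.

Lemma prep_epsV g : p g * peps g^-1%g = p g.
Proof. by rewrite /peps invgK mulrA prepK. Qed.

Lemma peps_prep g : peps g * p g = p g.
Proof. exact: prepK. Qed.

Lemma conj_eps g x : x \in eps_pred -> p g * x * p g^-1%g \in eps_pred.
Proof.
have [e1 eL eM] := eps_subalg.
suff H : forall x, x \in eps_pred -> x \in eps_pred /\ p g * x * p g^-1%g \in eps_pred.
  by move=> /H[].
apply: eps_ind.
- by split=> //; rewrite mulr1; exact: peps_in.
- move=> k y z [yP cy] [zP cz]; split; first exact: eL.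
  by rewrite mulrDr mulrDl -scalerAr -scalerAl; exact: eL.
- move=> y z [yP cy] [zP cz]; split; first exact: eM.
  have -> : p g * (y * z) * p g^-1%g = (p g * y * p g^-1%g) * (p g * z * p g^-1%g).
    rewrite -[p g in LHS]prep_epsV -[p g * _ * _]mulrA [peps _ * (_ * _)]mulrA.
    by rewrite eps_comm// /peps invgK !mulrA.
  exact: eM.
move=> h; split; first exact: peps_in.
by rewrite prep_eps -mulrA; apply: eM; exact: peps_in.
Qed.

(* The subalgebra generated by the eps_g; it is automatically unital since
   eps_1 = 1. *)
Record eps_alg := EpsAlg { eps_val : B; eps_valP : eps_val \in eps_pred }.

HB.instance Definition _ := [isSub of eps_alg for eps_val].
HB.instance Definition _ := [Choice of eps_alg by <:].
HB.instance Definition _ :=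
  GRing.SubChoice_isSubAlgebra.Build K B eps_pred eps_alg eps_subalg.

Definition eps_elt g : eps_alg := EpsAlg (peps_in g).

Definition alpha_dom g : set eps_alg := [set eps_elt g * a | a in [set: eps_alg]].

Definition alpha_map g (a : eps_alg) : eps_alg := EpsAlg (conj_eps g (valP a)).

Lemma alpha_domP g a : alpha_dom g a <-> peps g * eps_val a = eps_val a.
Proof.
split=> [[b _ <-]|aE]; first by rewrite /= mulrA peps_idem.
by exists a => //; exact/val_inj.
Qed.

Lemma alpha_dom_ideal g : two_sided_ideal (alpha_dom g).
Proof.
split.
- by apply/alpha_domP; rewrite /= mulr0.
- move=> k x y /alpha_domP xE /alpha_domP yE; apply/alpha_domP => /=.
  by rewrite mulrDr -scalerAr xE yE.
move=> a x /alpha_domP xE; split; apply/alpha_domP; rewrite /= mulrA ?xE//.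
by rewrite eps_comm ?(valP a)// -mulrA xE.
Qed.

Lemma alpha_mapK g a : alpha_dom g^-1%g a -> alpha_map g^-1%g (alpha_map g a) = a.
Proof.
move=> /alpha_domP aE; apply/val_inj => /=; rewrite invgK.
have -> : p g^-1%g * (p g * eps_val a * p g^-1%g) * p g
    = peps g^-1%g * eps_val a * peps g^-1%g by rewrite /peps invgK !mulrA.
by rewrite aE -eps_comm ?aE//; exact: valP.
Qed.

Lemma alpha_map_dom g a : alpha_dom g (alpha_map g a).
Proof. by apply/alpha_domP; rewrite /= !mulrA peps_prep. Qed.

Lemma alpha_map_iso g : alg_iso_on (alpha_dom g^-1%g) (alpha_dom g) (alpha_map g).
Proof.
split.
- split=> [a _|a b|b Db]; first exact: alpha_map_dom.
    by rewrite !inE => /alpha_mapK aE /alpha_mapK bE ab; rewrite -aE ab bE.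
  exists (alpha_map g^-1%g b); first exact: alpha_map_dom.
  by rewrite -{1}[g]invgK alpha_mapK// invgK.
- move=> k x y _ _; apply/val_inj => /=.
  by rewrite mulrDr mulrDl -scalerAr -scalerAl.
move=> x y /alpha_domP xE _; apply/val_inj => /=.
rewrite -{1}xE eps_comm; last exact: valP.
by rewrite /peps invgK !mulrA.
Qed.

Lemma alpha_dom1 : alpha_dom 1%g = [set: eps_alg].
Proof. by apply/seteqP; split=> // a _; apply/alpha_domP; rewrite peps1 mul1r. Qed.

Lemma alpha_map1 a : alpha_map 1%g a = a.
Proof. by apply/val_inj; rewrite /= invg1 prep1 mul1r mulr1. Qed.

Lemma alpha_dom_comp g h :
  alpha_dom h^-1%g `&` alpha_map h @^-1` (alpha_dom h `&` alpha_dom g^-1%g)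
  `<=` alpha_dom (g * h)^-1%g.
Proof.
move=> a [Da [_ /alpha_domP /= bE]]; have /(congr1 val) /= aE := alpha_mapK Da.
have E : p h^-1%g * (peps g^-1%g * (p h * eps_val a * p h^-1%g)) * p h
    = peps (g * h)^-1%g * (p h^-1%g * (p h * eps_val a * p h^-1%g) * p h).
  by rewrite mulrA prep_eps invgM !mulrA.
rewrite bE invgK in E aE; apply/alpha_domP; rewrite aE in E.
by rewrite -E.
Qed.

Lemma alpha_map_comp g h a :
  (alpha_dom h^-1%g `&` alpha_map h @^-1` (alpha_dom h `&` alpha_dom g^-1%g)) a ->
  alpha_map g (alpha_map h a) = alpha_map (g * h)%g a.
Proof.
move=> [/alpha_domP aE _]; apply/val_inj => /=.
have aC : eps_val a * peps h^-1%g = eps_val a by rewrite -eps_comm// (valP a).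
have L : p g * p h * peps h^-1%g = p (g * h)%g * peps h^-1%g.
  by rewrite /peps !mulrA prepMV.
have R : peps h^-1%g * (p h^-1%g * p g^-1%g) = peps h^-1%g * p (g * h)^-1%g.
  have := prepK h^-1%g; rewrite /peps invgK => Kh.
  by rewrite mulrA Kh prepVM invgM mulVKg.
have aE2 : eps_val a = peps h^-1%g * eps_val a * peps h^-1%g by rewrite aE aC.
transitivity (p g * p h * eps_val a * (p h^-1%g * p g^-1%g)); first by rewrite !mulrA.
move: (peps _) L R aE2 {aE aC} => e L R aE2.
rewrite [in LHS]aE2 [in RHS]aE2 -!mulrA R [in RHS]mulrA.
by rewrite mulrA [LHS]mulrA L !mulrA.
Qed.

Definition pact_of_prep : partial_action G eps_alg :=
  PartialAction alpha_dom_ideal alpha_map_iso alpha_dom1 alpha_map1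
    alpha_dom_comp alpha_map_comp.


End AlphaOf.

(* K^n for n > 0 is Kn K n.-1: throughout, the dimension is the successor of the
   parameter n, which keeps the algebras below nonzero. *)
Definition Kn (K : fieldType) (n : nat) : Type := {ffun 'I_n.+1 -> K}.

Section Kn.
Variables (K : fieldType) (n : nat).
Local Notation V := (Kn K n).

HB.instance Definition _ := GRing.PzRing.copy V {ffun 'I_n.+1 -> K}.

Lemma Kn_one_neq0 : (1 : V) != 0.
Proof. by apply/eqP => /ffunP/(_ ord0)/eqP; rewrite !ffunE oner_eq0. Qed.

HB.instance Definition _ := GRing.PzSemiRing_isNonZero.Build V Kn_one_neq0.

Definition Kn_scale (k : K) (x : V) : V := [ffun i => k * x i].

Lemma Kn_scalerA a b x : Kn_scale a (Kn_scale b x) = Kn_scale (a * b) x.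
Proof. by apply/ffunP => i; rewrite !ffunE mulrA. Qed.

Lemma Kn_scale1r : left_id 1 Kn_scale.
Proof. by move=> x; apply/ffunP => i; rewrite !ffunE mul1r. Qed.

Lemma Kn_scalerDr : right_distributive Kn_scale +%R.
Proof. by move=> a x y; apply/ffunP => i; rewrite !ffunE mulrDr. Qed.

Lemma Kn_scalerDl x : {morph Kn_scale^~ x : a b / a + b}.
Proof. by move=> a b; apply/ffunP => i; rewrite !ffunE mulrDl. Qed.

HB.instance Definition _ := GRing.Zmodule_isLmodule.Build K V
  Kn_scalerA Kn_scale1r Kn_scalerDr Kn_scalerDl.

Lemma Kn_scalerAl (a : K) (x y : V) : a *: (x * y) = a *: x * y.
Proof. by apply/ffunP => i; rewrite !ffunE mulrA. Qed.

Lemma Kn_scalerAr (a : K) (x y : V) : a *: (x * y) = x * (a *: y).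
Proof. by apply/ffunP => i; rewrite !ffunE mulrCA. Qed.

HB.instance Definition _ := GRing.Lmodule_isLalgebra.Build K V Kn_scalerAl.
HB.instance Definition _ := GRing.Lalgebra_isAlgebra.Build K V Kn_scalerAr.

End Kn.

Lemma Kn_unital (K : fieldType) (G : groupType) (n : nat)
    (al : partial_action G (Kn K n)) : unital_pact al.
Proof.
move=> g; pose P i := `[< exists2 x, pdom al g x & x i != 0 >].
pose d i : Kn K n := [ffun j => (j == i)%:R].
pose e : Kn K n := \sum_(i | P i) d i.
have eE j : e j = (P j)%:R.
  rewrite /e sum_ffunE; have [Pj|Pj] := boolP (P j).
    rewrite (bigD1 j)//= ffunE eqxx big1 ?addr0// => i /andP[_ ij].
    by rewrite ffunE eq_sym (negbTE ij).
  rewrite big1// => i Pi; rewrite ffunE; case: eqP => // ji.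
  by rewrite ji Pi in Pj.
exists e; split.
  apply: pdom_sum => i /asboolP[x Dx xi].
  have -> : d i = ((x i)^-1 *: d i : Kn K n) * x.
    apply/ffunP => j; rewrite !ffunE; case: eqP => [->|_].
      by rewrite mulr1 mulVf.
    by rewrite mulr0 mul0r.
  exact: pdomMl.
move=> x Dx.
have Pe j : ~~ P j -> x j = 0.
  by move=> /asboolPn NP; apply/eqP; apply: contraPT NP => xj; apply; exists x.
by split; apply/ffunP => j; rewrite ffunE eE;
  have [_|/Pe ->] := boolP (P j); rewrite ?mul1r ?mulr1 ?mul0r ?mulr0.
Qed.

(* A_i(alpha) = {g | (1_g)_(i,i) <> 0}; the indices 1, ..., n are shifted to
   0, ..., n - 1. *)
Definition supp_at (K : fieldType) (G : groupType) (n : nat)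
    (al : partial_action G (Kn K n)) (i : 'I_n.+1) : set G :=
  [set g | (pone al g : Kn K n) i != 0].

Section GroupAlgebra.
Variables (K : fieldType) (H : groupType).

Lemma triv_ideal (h : H) : two_sided_ideal [set: K^o].
Proof. by []. Qed.

Lemma triv_iso (h : H) : alg_iso_on [set: K^o] [set: K^o] id.
Proof. by split=> //; split=> // x _; exists x. Qed.

Definition triv_pact : partial_action H K^o :=
  @PartialAction K H K^o (fun=> setT) (fun=> id) triv_ideal triv_iso
    erefl (fun=> erefl) (fun _ _ _ _ => I) (fun _ _ _ _ => erefl).

Lemma triv_unital : unital_pact triv_pact.
Proof. by move=> h; exists 1; split=> // x _; rewrite mul1r mulr1. Qed.

(* KH is the skew group ring for the trivial global action of H on K: finite
   sums of terms a_h delta_h, with (a delta_g)(b delta_h) = ab delta_gh. *)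
Definition group_alg : algType K := skew_ring triv_unital.

Definition group_basis (h : H) : group_alg :=
  SkewRing triv_unital (skew_mono_pred (I : pdom triv_pact h (1 : K^o))).

End GroupAlgebra.

(* n.+1 x n.+1 matrices over a K-algebra A, as a K-algebra (the library only
   provides the A-module structure). *)
Definition mx_alg (K : fieldType) (A : algType K) (n : nat) : Type := 'M[A]_n.+1.

Section MxAlg.
Variables (K : fieldType) (A : algType K) (n : nat).
Local Notation M := (mx_alg A n).

HB.instance Definition _ := GRing.NzRing.copy M 'M[A]_n.+1.

Definition mx_alg_scale (k : K) (X : M) : M := map_mx (fun a => k *: a) X.

Lemma mx_alg_scalerA a b x : mx_alg_scale a (mx_alg_scale b x) = mx_alg_scale (a * b) x.
Proof. by apply/matrixP => i j; rewrite !mxE scalerA. Qed.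

Lemma mx_alg_scale1r : left_id 1 mx_alg_scale.
Proof. by move=> x; apply/matrixP => i j; rewrite !mxE scale1r. Qed.

Lemma mx_alg_scalerDr : right_distributive mx_alg_scale +%R.
Proof. by move=> a x y; apply/matrixP => i j; rewrite !mxE scalerDr. Qed.

Lemma mx_alg_scalerDl x : {morph mx_alg_scale^~ x : a b / a + b}.
Proof. by move=> a b; apply/matrixP => i j; rewrite !mxE scalerDl. Qed.

HB.instance Definition _ := GRing.Zmodule_isLmodule.Build K M
  mx_alg_scalerA mx_alg_scale1r mx_alg_scalerDr mx_alg_scalerDl.

Lemma mx_alg_scalerAl (a : K) (x y : M) : a *: (x * y) = a *: x * y.
Proof.
apply/matrixP => i j; rewrite !mxE scaler_sumr; apply: eq_bigr => k _.
by rewrite !mxE scalerAl.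
Qed.

Lemma mx_alg_scalerAr (a : K) (x y : M) : a *: (x * y) = x * (a *: y).
Proof.
apply/matrixP => i j; rewrite !mxE scaler_sumr; apply: eq_bigr => k _.
by rewrite !mxE scalerAr.
Qed.

HB.instance Definition _ := GRing.Lmodule_isLalgebra.Build K M mx_alg_scalerAl.
HB.instance Definition _ := GRing.Lalgebra_isAlgebra.Build K M mx_alg_scalerAr.

End MxAlg.

Record subgrp (G : groupType) (H : groupClosed G) :=
  SubGrp { subgrp_val : G; subgrp_valP : subgrp_val \in H }.

Section SubGrp.
Variables (G : groupType) (H : groupClosed G).

Lemma subgrp_closed : group_closed (fun x : G => x \in H).
Proof. by split=> [|x y xH yH]; [exact: gpred1 | exact: gpredF]. Qed.

HB.instance Definition _ := [isSub of subgrp H for @subgrp_val G H].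
HB.instance Definition _ := [Choice of subgrp H by <:].
HB.instance Definition _ :=
  SubChoice_isSubGroup.Build G (fun x : G => x \in H) (subgrp H) subgrp_closed.

End SubGrp.

Definition ltranslate (G : groupType) (g : G) (A : set G) : set G :=
  [set (g * a)%g | a in A].

Definition stabilizer (G : groupType) (A : set G) : set G :=
  [set h | ltranslate h A = A].

Definition right_cosets (G : groupType) (H A : set G) : set (set G) :=
  [set [set (h * a)%g | h in H] | a in A].

Definition stab_index (G : groupType) (H : groupClosed G) (m : nat)
    (A : set G) : Prop :=
  stabilizer A = [set` H] /\ (right_cosets [set` H] A #= `I_m)%card.

(* A set A as in the definition of an elementary partial representation,
   together with an enumeration A_1 = A, ..., A_n of its translates containing 1
   and elements g_i with g_i A = A_i. *)
Record elem_data (G : groupType) (H : groupClosed G) (n : nat) := ElemData {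
  ed_set : set G;
  ed_set1 : ed_set 1%g;
  ed_stab : stab_index H n.+1 ed_set;
  ed_obj : 'I_n.+1 -> set G;
  ed_obj0 : ed_obj ord0 = ed_set;
  ed_obj_inj : injective ed_obj;
  ed_objE : range ed_obj = [set ltranslate g ed_set | g in [set g | ed_set g^-1%g]];
  ed_rep : 'I_n.+1 -> G;
  ed_repE : forall i, ltranslate (ed_rep i) ed_set = ed_obj i
}.

Section Elementary.
Variables (K : fieldType) (G : groupType) (H : groupClosed G) (n : nat).
Local Notation KH := (group_alg K (subgrp H)).
Variable E : elem_data H n.

(* A morphism (A_i, g) : A_i -> A_j of Gamma is the triple (i, g, j). *)
Definition gpd_mor :=
  {m : 'I_n.+1 * G * 'I_n.+1 |
    `[< ltranslate m.1.2 (ed_obj E m.1.1) = ed_obj E m.2 >]}.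

Definition mor_src (m : gpd_mor) : 'I_n.+1 := (val m).1.1.
Definition mor_elt (m : gpd_mor) : G := (val m).1.2.
Definition mor_tgt (m : gpd_mor) : 'I_n.+1 := (val m).2.

(* Elements of K Gamma are given by their coefficient functions on the basis of
   morphisms. A morphism (A_i, g) automatically satisfies g^-1 \in A_i, so
   lambda(g) is the sum of all the morphisms with second component g. *)
Definition gpd_lambda (g : G) : gpd_mor -> K := fun m => (mor_elt m == g)%:R.

(* e_(j,i)(h) *)
Definition mx_elem (j i : 'I_n.+1) (h : subgrp H) : mx_alg KH n :=
  \matrix_(k, l) if (k == j) && (l == i) then group_basis K h else 0.

(* The element g_j^-1 g g_i always lies in H, so that the default value of
   insubd is never used. *)
Definition gpd_tau1 (m : gpd_mor) : mx_alg KH n :=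
  mx_elem (mor_tgt m) (mor_src m)
    (insubd (1%g : subgrp H)
      ((ed_rep E (mor_tgt m))^-1 * mor_elt m * ed_rep E (mor_src m))%g).

Definition gpd_tau (f : gpd_mor -> K) : mx_alg KH n :=
  \sum_(m \in [set: gpd_mor]) f m *: gpd_tau1 m.

End Elementary.
Arguments gpd_lambda K {G H n} E g m.

Definition elementary (K : fieldType) (G : groupType) (H : groupClosed G)
    (n : nat) (p : partial_rep G (mx_alg (group_alg K (subgrp H)) n)) : Prop :=
  exists E : elem_data H n, forall g, p g = gpd_tau (gpd_lambda K E g).

Definition elementary_class (K : fieldType) (G : groupType) (H : groupClosed G)
    (n : nat) (C : any_prep K G -> Prop) : Prop :=
  exists2 p : partial_rep G (mx_alg (group_alg K (subgrp H)) n),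
    elementary p & C = prep_class p.

Definition Kn_pact_class (K : fieldType) (G : groupType) (H : groupClosed G)
    (n : nat) (D : any_pact K G -> Prop) : Prop :=
  exists2 al : partial_action G (Kn K n),
    stab_index H n.+1 (supp_at al ord0) & D = pact_class al.

Lemma Kn_pact_class_unital (K : fieldType) (G : groupType) (H : groupClosed G)
    (n : nat) (D : any_pact K G -> Prop) (be : any_pact K G) :
  Kn_pact_class H n D -> D be -> unital_pact be.
Proof. by move=> [al _ ->] /unital_pact_equiv; apply; exact: Kn_unital. Qed.

(* Main.v *)
Require Import Defs.
From HB Require Import structures.
From mathcomp Require Import all_boot all_algebra finmap.
From mathcomp Require Import boolp classical_sets functions cardinality fsbigop.

(* For a partial action alpha on K^n the minimal idempotent e_i lies in D_g iff
   g is in A_i = A_i(alpha), and alpha_g sends e_i to the e_j with g A_i = A_j.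
   So once the A_i are pairwise distinct they determine alpha, and
   e_j delta_g <-> (A_i, g), g A_i = A_j, identifies the skew group ring with the
   groupoid algebra K Gamma, hence with M_n(KH), carrying 1_g delta_g to
   tau (lambda g).
   If St(A_1) = H and (A_1 : H) = n, the n cosets H a in A_1 give n distinct
   translates a^-1 A_1, each of them some A_j: the A_j are these translates, and
   pi_alpha is elementary. Conversely the sets A_i of an elementary pi are those
   of a partial action alpha on K^n, and pi is equivalent to pi_alpha.
   It remains to see that alpha^(pi_alpha) is equivalent to alpha, that is, that
   the 1_g generate K^n; this holds because distinct A_i are separated by
   membership of some g. *)

Set Implicit Arguments.
Unset Strict Implicit.
Unset Printing Implicit Defensive.

Import GRing.Theory.
Local Open Scope classical_set_scope.
Local Open Scope ring_scope.

(** * Building and inverting algebra morphisms *)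

Lemma ex_lrmorphism (K : fieldType) (A B : algType K) (f : A -> B) :
  linear f -> f 1 = 1 -> {morph f : x y / x * y} ->
  exists phi : {lrmorphism A -> B}, phi = f :> (A -> B).
Proof.
move=> flin f1 fM.
pose lin := GRing.isLinear.Build K A B *:%R f flin.
pose mon := GRing.isMonoidMorphism.Build A B f (f1, fM).
pose phi : {lrmorphism A -> B} := HB.pack f lin mon.
by exists phi.
Qed.

Lemma lrmorphism_inv (K : fieldType) (A B : algType K)
    (phi : {lrmorphism A -> B}) :
  bijective phi -> exists psi : {lrmorphism B -> A}, cancel phi psi /\ cancel psi phi.
Proof.
move=> [f phiK fK].
have [||| psi psiE] := @ex_lrmorphism K B A f.
- by move=> k x y; apply: (can_inj phiK); rewrite linearP /= !fK.
- by apply: (can_inj phiK); rewrite rmorph1 fK.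
- by move=> x y; apply: (can_inj phiK); rewrite rmorphM /= !fK.
by exists psi; rewrite psiE.
Qed.

(** * Equivalences and the two maps *)

Section Equivalences.
Variables (K : fieldType) (G : groupType).

Lemma prep_equiv_sym (B B' : algType K) (p : partial_rep G B)
    (p' : partial_rep G B') :
  prep_equiv p p' -> prep_equiv p' p.
Proof.
move=> [phi /lrmorphism_inv[psi [phiK psiK]] pE].
by exists psi => [|g]; [exists phi | rewrite pE phiK].
Qed.

Lemma prep_equiv_trans (B B' B'' : algType K) (p : partial_rep G B)
    (p' : partial_rep G B') (p'' : partial_rep G B'') :
  prep_equiv p p' -> prep_equiv p' p'' -> prep_equiv p p''.
Proof.
move=> [phi phib pE] [psi psib p'E].
exists (phi \o psi : {lrmorphism B'' -> B}) => [|g /=]; first exact: bij_comp.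
by rewrite pE p'E.
Qed.

Lemma prep_class_eq (B B' : algType K) (p : partial_rep G B)
    (p' : partial_rep G B') :
  prep_equiv p p' -> prep_class p = prep_class p'.
Proof.
move=> pp'; apply/funext => q; apply/propext; split=> qE.
  exact: prep_equiv_trans qE pp'.
exact: prep_equiv_trans qE (prep_equiv_sym pp').
Qed.

Lemma prep_class_refl (q : any_prep K G) : prep_class q q.
Proof. by exists idfun => //; exists idfun. Qed.

Lemma pact_equiv_sym (A A' : algType K) (al : partial_action G A)
    (al' : partial_action G A') :
  pact_equiv al al' -> pact_equiv al' al.
Proof.
move=> [phi phib alE]; have [psi [phiK psiK]] := lrmorphism_inv phib.
exists psi => [|g]; first by exists phi.
have [Dg actg] := alE g; have [DgV _] := alE g^-1%g; split.
  rewrite -Dg; apply/seteqP; split=> [_ [_ [x Dx <-] <-]|x Dx].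
    by rewrite phiK.
  by exists (phi x); [exists x | rewrite phiK].
by move=> x; rewrite -DgV => -[y Dy <-]; rewrite actg// !phiK.
Qed.

Lemma pact_equiv_trans (A A' A'' : algType K) (al : partial_action G A)
    (al' : partial_action G A') (al'' : partial_action G A'') :
  pact_equiv al al' -> pact_equiv al' al'' -> pact_equiv al al''.
Proof.
move=> [phi phib alE] [psi psib al'E].
exists (psi \o phi : {lrmorphism A -> A''}) => [|g /=]; first exact: bij_comp.
have [Dg actg] := alE g; have [DgV _] := alE g^-1%g.
have [D'g act'g] := al'E g; split; first by rewrite -D'g -Dg image_comp.
move=> x Dx; rewrite act'g ?actg//; rewrite -DgV; by exists x.
Qed.

Lemma pact_class_eq (A A' : algType K) (al : partial_action G A)
    (al' : partial_action G A') :
  pact_equiv al al' -> pact_class al = pact_class al'.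
Proof.
move=> aa; apply/funext => q; apply/propext; split=> qE.
  exact: pact_equiv_trans qE aa.
exact: pact_equiv_trans qE (pact_equiv_sym aa).
Qed.

Lemma pact_class_refl (al : any_pact K G) : pact_class al al.
Proof.
exists idfun => [|g]; first by exists idfun.
by split=> //; rewrite image_id.
Qed.

Section PrepMap.
Variables (B B' : algType K) (phi : {lrmorphism B -> B'}) (p : partial_rep G B).

Definition prep_map : partial_rep G B'.
Proof.
exists (fun g => phi (p g)); first by rewrite prep1 rmorph1.
- by move=> g h; rewrite -!rmorphM prepMV.
- by move=> g h; rewrite -!rmorphM prepVM.
Defined.

End PrepMap.

(** An isomorphism carrying [p] to [p'] carries each [peps p g] to [peps p' g], so it restricts to
    the generated subalgebras, where it respects conjugation by the values at $g$. *)
Lemma pact_of_prep_equiv (B B' : algType K) (p : partial_rep G B)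
    (p' : partial_rep G B') :
  prep_equiv p p' -> pact_equiv (pact_of_prep p) (pact_of_prep p').
Proof.
move=> /prep_equiv_sym[phi /lrmorphism_inv[psi [phiK psiK]] pE].
have epsE g : phi (peps p g) = peps p' g by rewrite rmorphM /= -!pE.
have epsE' g : psi (peps p' g) = peps p g by rewrite -epsE phiK.
have phi_eps x : x \in eps_pred p -> phi x \in eps_pred p'.
  have [e1 eL eM] := eps_subalg p'; move: x; apply: eps_ind.
  - by rewrite rmorph1.
  - by move=> k x y Px Py; rewrite linearP; apply: eL.
  - by move=> x y Px Py; rewrite rmorphM; apply: eM.
  - by move=> g; rewrite epsE; apply: peps_in.
have psi_eps x : x \in eps_pred p' -> psi x \in eps_pred p.
  have [e1 eL eM] := eps_subalg p; move: x; apply: eps_ind.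
  - by rewrite rmorph1.
  - by move=> k x y Px Py; rewrite linearP; apply: eL.
  - by move=> x y Px Py; rewrite rmorphM; apply: eM.
  - by move=> g; rewrite epsE'; apply: peps_in.
pose f (x : eps_alg p) : eps_alg p' := EpsAlg (phi_eps _ (valP x)).
pose f' (x : eps_alg p') : eps_alg p := EpsAlg (psi_eps _ (valP x)).
have fK : cancel f f' by move=> x; apply/val_inj => /=; rewrite phiK.
have f'K : cancel f' f by move=> x; apply/val_inj => /=; rewrite psiK.
have [||| chi chiE] := @ex_lrmorphism K _ _ f.
- by move=> k x y; apply/val_inj => /=; rewrite linearP.
- by apply/val_inj => /=; rewrite rmorph1.
- by move=> x y; apply/val_inj => /=; rewrite rmorphM.
exists chi; rewrite chiE; first by exists f'.
move=> g; split.
  apply/seteqP; split=> [_ [x /alpha_domP xE <-]|x /alpha_domP xE].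
    by apply/alpha_domP => /=; rewrite -epsE -rmorphM xE.
  exists (f' x); last by rewrite f'K.
  by apply/alpha_domP => /=; rewrite -epsE' -rmorphM xE.
by move=> x _; apply/val_inj => /=; rewrite !rmorphM /= !pE.
Qed.

(** Since $\varphi(D_g) = D'_g$, the unity of $D_g$ goes to that of $D'_g$. Applying $\varphi$ to
    every coefficient is multiplicative because $\varphi$ intertwines the actions. *)
Lemma prep_of_pact_equiv (A A' : algType K) (al : partial_action G A)
    (al' : partial_action G A') (u : unital_pact al) (u' : unital_pact al') :
  pact_equiv al al' -> prep_equiv (prep_of_pact u) (prep_of_pact u').
Proof.
move=> aa; apply: prep_equiv_sym; case: (aa) => phi phib alE.
have [psi [phiK psiK]] := lrmorphism_inv phib.
have phiD g x : pdom al g x -> pdom al' g (phi x).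
  by have [<- _] := alE g; exists x.
have psiD g x : pdom al' g x -> pdom al g (psi x).
  by have [<- _] := alE g; move=> [y Dy <-]; rewrite phiK.
have phi1 g : phi (pone al g) = pone al' g.
  have Dg := phiD _ _ (pone_dom u g); rewrite -[LHS](pone_mulr u' Dg).
  have := psiD _ _ (pone_dom u' g) => /(pone_mull u)/(congr1 phi).
  by rewrite rmorphM /= !psiK.
have phi_skew f : f \in skew_pred al -> phi \o f \in skew_pred al'.
  move=> /skew_predP[fin Df]; apply/skew_predP; split=> [|g]; last exact: phiD.
  by apply: sub_finite_set fin => g /=; apply: contraNN => /eqP->; rewrite rmorph0.
have psi_skew f : f \in skew_pred al' -> psi \o f \in skew_pred al.
  move=> /skew_predP[fin Df]; apply/skew_predP; split=> [|g]; last exact: psiD.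
  by apply: sub_finite_set fin => g /=; apply: contraNN => /eqP->; rewrite rmorph0.
pose f (x : skew_ring u) : skew_ring u' := SkewRing u' (phi_skew _ (valP x)).
pose f' (x : skew_ring u') : skew_ring u := SkewRing u (psi_skew _ (valP x)).
have mono a g : phi \o skew_mono a g = skew_mono (phi a) g.
  by apply/funext => h; rewrite /skew_mono /=; case: ifP => //; rewrite rmorph0.
have [||| chi chiE] := @ex_lrmorphism K _ _ f.
- by move=> k x y; apply/val_inj/funext => g /=; rewrite linearP.
- by apply/val_inj; rewrite /= mono phi1.
- move=> [x xP] [y yP]; apply/val_inj/funext => k /=.
  have [F FP] := skew_fset xP.
  rewrite (skew_mulE _ _ _ FP) (@skew_mulE _ _ _ _ F); last first.
    by move=> g /FP /= ->; rewrite rmorph0.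
  rewrite rmorph_sum /=; apply: eq_bigr => g _.
  have [_ <-] := alE g; last by apply: pdomMr; exact/pact_domV/skew_dom.
  have [_ actV] := alE g^-1%g; rewrite rmorphM actV// invgK; exact: skew_dom.
exists chi; rewrite chiE.
  exists f' => x; apply/val_inj/funext => g /=; rewrite ?phiK ?psiK//.
by move=> g; apply/val_inj; rewrite /= mono phi1.
Qed.

(** The equivalence is $a \mapsto a\delta_1$. Since $\varepsilon_g = 1_g\delta_1$, the subalgebra
    generated by the $\varepsilon_g$ is the image of the one generated by the $1_g$, which is all of
    [A] by hypothesis. *)
Lemma pact_of_prep_of_pact (A : algType K) (al : partial_action G A)
    (u : unital_pact al) :
  (forall S : {pred A}, GRing.subalg_closed S ->
    (forall g, pone al g \in S) -> forall x, x \in S) ->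
  pact_equiv (pact_of_prep (prep_of_pact u)) al.
Proof.
move=> gen; apply: pact_equiv_sym; set p := prep_of_pact u.
have D1 a : pdom al 1%g a by rewrite pdom1.
pose d a : skew_ring u := SkewRing u (skew_mono_pred (D1 a)).
have dL k a b : d (k *: a + b) = k *: d a + d b.
  apply/val_inj/funext => g /=; rewrite addrfctE scalrfctE /skew_mono.
  by case: ifP; rewrite // scaler0 addr0.
have d1 : d 1 = 1 by apply/val_inj; rewrite /= pone1.
have dM a b : d (a * b) = d a * d b.
  by apply/val_inj; rewrite /= skew_mul_mono mulg1 invg1 !pact1.
have dE g : peps p g = d (pone al g).
  by apply/val_inj; rewrite pi_funM /= mulgV pone1// mulr1.
(* The $a$ with $a\delta_1$ in the generated subalgebra themselves form a subalgebra containing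
   every $1_g$. *)
have d_eps a : d a \in eps_pred p.
  have [e1 eL eM] := eps_subalg p.
  pose S : {pred A} := fun a => d a \in eps_pred p.
  have SE b : (b \in S) = (d b \in eps_pred p) by [].
  rewrite -SE; apply: gen => [|g]; last by rewrite SE -dE; exact: peps_in.
  split; first by rewrite SE d1.
    by move=> k x y; rewrite !SE dL; exact: eL.
  by move=> x y; rewrite !SE dM; exact: eM.
have epsd x : x \in eps_pred p -> x = d (val x 1%g).
  move=> xP; suff [a ->] : exists a, x = d a by rewrite /= /skew_mono eqxx.
  move: x xP; apply: eps_ind.
  - by exists 1.
  - by move=> k _ _ [a ->] [b ->]; exists (k *: a + b); rewrite dL.
  - by move=> _ _ [a ->] [b ->]; exists (a * b); rewrite dM.
  - by move=> g; exists (pone al g).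
pose f a : eps_alg p := EpsAlg (d_eps a).
pose f' (x : eps_alg p) : A := val (eps_val x) 1%g.
have fK : cancel f f' by move=> a; rewrite /f' /= /skew_mono eqxx.
have f'K : cancel f' f by move=> x; apply/val_inj; rewrite /= -epsd//; exact: valP.
have [||| chi chiE] := @ex_lrmorphism K _ _ f.
- by move=> k x y; apply/val_inj; rewrite /= dL.
- by apply/val_inj; rewrite /= d1.
- by move=> x y; apply/val_inj; rewrite /= dM.
exists chi; rewrite chiE; first by exists f'.
move=> g; split.
  apply/seteqP; split=> [_ [x Dx <-]|x /alpha_domP xE].
    by apply/alpha_domP; rewrite /= dE -dM pone_mull.
  exists (f' x); last by rewrite f'K.
  move: xE; rewrite dE -[x]f'K /= -dM fK => /(congr1 (fun x => val x 1%g)) /=.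
  rewrite /skew_mono eqxx => <-; apply: pdomMr; exact: pone_dom.
move=> x Dx; apply/val_inj => /=.
(* Conjugation in two stages: first $1_g\delta_g \cdot x\delta_1 = \alpha_g(x)\delta_g$, then right
   multiplication by $1_{g^{-1}}\delta_{g^{-1}}$ gives $\alpha_g(x)\delta_1$. *)
have -> : pi_fun u g * d x = SkewRing u (skew_mono_pred (pact_dom Dx)).
  apply/val_inj; rewrite /= skew_mul_mono mulg1 -[g in pone al g]invgK.
  by rewrite pact_pone// pone_mull.
apply/val_inj; rewrite /= skew_mul_mono mulgV pactK//.
by rewrite pone_mulr.
Qed.

End Equivalences.

(** * Partial actions on K^n *)

Section LeftTranslates.
Variable G : groupType.
Implicit Types (g h x : G) (A B : set G).

Lemma ltranslateP g A x : ltranslate g A x <-> A (g^-1 * x)%g.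
Proof.
split=> [[y Ay <-]|Ax]; first by rewrite mulKg.
by exists (g^-1 * x)%g => //; rewrite mulVKg.
Qed.

Lemma ltranslateM g h A : ltranslate (g * h)%g A = ltranslate g (ltranslate h A).
Proof.
apply/funext => x; apply/propext.
by rewrite !ltranslateP invgM mulgA.
Qed.

Lemma ltranslate1 A : ltranslate 1%g A = A.
Proof. by apply/funext => x; apply/propext; rewrite ltranslateP invg1 mul1g. Qed.

Lemma ltranslateV g A B : ltranslate g A = B <-> ltranslate g^-1%g B = A.
Proof.
by split=> <-; rewrite -ltranslateM ?mulVg ?mulgV ltranslate1.
Qed.

End LeftTranslates.

Definition Kn_delta (K : fieldType) (n : nat) (i : 'I_n.+1) : Kn K n :=
  [ffun j => (j == i)%:R].

Section KnAlgebra.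
Variables (K : fieldType) (n : nat).
Local Notation V := (Kn K n).
Local Notation d := (@Kn_delta K n).
Implicit Types (x y : V) (i j : 'I_n.+1).

Lemma Kn_mulC x y : x * y = y * x.
Proof. by apply/ffunP => i; rewrite !ffunE mulrC. Qed.

Lemma Kn_mul_delta x i : x * d i = x i *: d i.
Proof. by apply/ffunP => j; rewrite !ffunE; case: eqP => [->//|]; rewrite !mulr0. Qed.

Lemma Kn_sum_delta x : x = \sum_i x i *: d i.
Proof.
apply/ffunP => j; rewrite sum_ffunE (bigD1 j)//= !ffunE eqxx mulr1.
rewrite big1 ?addr0// => i ij.
by rewrite !ffunE eq_sym (negbTE ij) mulr0.
Qed.

(* The idempotent at i is the product over j of elements that are 1 at i and 0
   at j. *)
Lemma Kn_generated (S : {pred V}) : GRing.subalg_closed S ->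
  (forall i j, i != j -> exists2 y, y \in S & y i = 1 /\ y j = 0) ->
  forall x, x \in S.
Proof.
move=> [S1 SL SM] sep x.
have S0 : 0 \in S by rewrite -(subrr 1) addrC -scaleN1r; exact: SL.
suff Sd i : d i \in S.
  rewrite [x]Kn_sum_delta; elim/big_rec: _ => // i y _ yS.
  exact: SL.
(* At $j = i$ nothing is separated; the value 1 is a placeholder that the product below skips. *)
have /choice[y yP] : forall j, exists y,
    y \in S /\ (j != i -> (y : V) i = 1 /\ (y : V) j = 0).
  move=> j; have [->|ij] := eqVneq i j; first by exists 1; split=> //; rewrite eqxx.
  by have [y Sy yE] := sep i j ij; exists y.
have -> : d i = \prod_(j | j != i) y j; last first.
  elim/big_rec: _ => // j z _ zS; apply: SM => //; by case: (yP j).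
have prodE k : (\prod_(j | j != i) y j : V) k = \prod_(j | j != i) y j k.
  apply: (big_morph (fun z : V => z k)) => [u v|]; by rewrite ffunE.
apply/ffunP => k; rewrite prodE ffunE; have [->|ki] := eqVneq k i.
  by rewrite big1// => j ji; case: (yP j) => _ /(_ ji)[].
by rewrite (bigD1 k)//=; case: (yP k) => _ /(_ ki)[_ ->]; rewrite mul0r.
Qed.

End KnAlgebra.

Section KnAction.
Variables (K : fieldType) (G : groupType) (n : nat).
Variable al : partial_action G (Kn K n).
Local Notation V := (Kn K n).
Local Notation d := (@Kn_delta K n).
Local Notation A := (supp_at al).
Implicit Types (x : V) (i j : 'I_n.+1) (g : G).

Let u : unital_pact al := Kn_unital al.

(** $1_g$ is idempotent, and a nonzero coordinate can be cancelled from $e^2 = e$. *)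
Lemma pone_supp g i : pone al g i = (`[< A i g >])%:R.
Proof.
case: asboolP => [/eqP gi|/negP]; last by rewrite negbK => /eqP.
have /ffunP/(_ i) := pone_mull u (pone_dom u g).
by rewrite ffunE => ee; apply: (mulfI (introN eqP gi)); rewrite mulr1.
Qed.

Lemma pdom_supp g x : pdom al g x <-> forall i, x i != 0 -> A i g.
Proof.
split=> [Dx i|H].
  rewrite /supp_at /=; apply: contraNN => /eqP gi.
  by have /ffunP/(_ i) := pone_mull u Dx; rewrite ffunE gi mul0r => <-.
have -> : x = pone al g * x; last by apply: pdomMr; exact: pone_dom.
apply/ffunP => i; rewrite ffunE pone_supp.
have [->|/H gi] := eqVneq (x i) 0; first by rewrite mulr0.
by rewrite asboolT// mul1r.
Qed.

Lemma pdom_delta g i : pdom al g (d i) <-> A i g.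
Proof.
rewrite pdom_supp; split=> [|Ag j]; first by apply; rewrite ffunE eqxx oner_eq0.
by rewrite ffunE; case: (eqVneq j i) => [->//|_]; rewrite eqxx.
Qed.

Lemma supp1 i : A i 1%g.
Proof. by apply/pdom_delta; rewrite pdom1. Qed.

(** $y = \alpha_g(e_i)$ is a nonzero idempotent, so $y_j = 1$ for some $j$; minimality of $e_i$ then
    forces $y = e_j$. *)
Lemma pact_delta g i : A i g^-1%g ->
  exists2 j, pact al g (d i) = d j & ltranslate g (A i) = A j.
Proof.
move=> /pdom_delta Di; set y := pact al g (d i).
have Dy : pdom al g y by exact: pact_dom.
have yy : y * y = y.
  rewrite /y -pactM// Kn_mul_delta ffunE eqxx scale1r//.
have [y0|[j yj]] : y = 0 \/ exists j, y j != 0.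
  have [->|/eqP yN] := eqVneq y 0; first by left.
  right; apply: contrapT => /forallNP yj; apply: yN; apply/ffunP => j.
  by rewrite ffunE; apply/eqP; apply: contrapT => /negP; exact: yj.
  have := pactK Di; rewrite -/y y0 pact0 => /ffunP/(_ i)/eqP.
  by rewrite !ffunE eqxx eq_sym oner_eq0.
have yj1 : y j = 1.
  by have /ffunP/(_ j) := yy; rewrite ffunE => ee; apply: (mulfI yj); rewrite mulr1.
have Dj : pdom al g (d j) by apply/pdom_delta/(pdom_supp g y).1.
have Dj' := pact_domV Dj.
set z := pact al g^-1%g (d j) in Dj'.
(* With $z = \alpha_g^{-1}(e_j)$: $e_j = e_j y = \alpha_g(z e_i) = z_i y$. Coordinate $j$ then gives
   $z_i = 1$. *)
have dj : d j = z i *: y.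
  rewrite -pactZ//= -Kn_mul_delta pactM// pactVK// Kn_mulC Kn_mul_delta yj1.
  by rewrite scale1r.
have zi : z i = 1.
  by have /ffunP/(_ j) := dj; rewrite !ffunE eqxx yj1 mulr1.
move: dj; rewrite zi scale1r => /esym yE; exists j; rewrite ?yE//.
(* Membership of $h$ in $A_j$ means $e_j \in D_h$; $\alpha_g$ and its inverse transport this to and
   from $e_i \in D_{g^{-1}h}$. *)
apply/seteqP; split=> h.
  move=> /ltranslateP Ah; apply/pdom_delta; rewrite -yE /y.
  rewrite -[h](mulVKg g); apply: pact_domI => //; exact/pdom_delta.
move=> Ah; apply/ltranslateP/pdom_delta.
rewrite -(pactK Di) -/y yE; apply: pact_domI; last exact/pdom_delta.
by rewrite invgK.
Qed.

Lemma pact_supp0 g j x : pdom al g^-1%g x -> ~ A j g -> pact al g x j = 0.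
Proof.
move=> /(pact_dom (al := al))/pdom_supp/(_ j) Dx gj.
by apply/eqP; apply: contrapT => /negP/Dx.
Qed.

Section Separated.
Hypothesis A_inj : injective A.

(** Injectivity of $i \mapsto A_i$ gives $\alpha_g(e_i) = e_j$. Apply $\alpha_g$ to $x e_i = x_i
    e_i$ and compare coordinates at $j$. *)
Lemma pact_coord g i j x : ltranslate g (A i) = A j -> pdom al g^-1%g x ->
  pact al g x j = x i.
Proof.
move=> gij Dx.
have Ai : A i g^-1%g.
  by have := supp1 j; rewrite -gij ltranslateP mulg1.
have [k gd gik] := pact_delta Ai.
have jk : j = k by apply: A_inj; rewrite -gij.
have Di : pdom al g^-1%g (d i) by exact/pdom_delta.
have := pactM Dx Di; rewrite gd -jk Kn_mul_delta pactZ// gd -jk Kn_mul_delta.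
by move=> /ffunP/(_ j); rewrite !ffunE eqxx !mulr1.
Qed.

(** If $g$ lies in exactly one of $A_i$, $A_j$, then $1_g$ or $1 - 1_g$ is 1 at $i$ and 0 at $j$. *)
Lemma pone_generated (S : {pred V}) : GRing.subalg_closed S ->
  (forall g, pone al g \in S) -> forall x, x \in S.
Proof.
move=> Salg Sone; apply: Kn_generated => // i j ij.
have [S1 SL SM] := Salg.
have [[g [gi gj]]|H] := pselect (exists g, A i g /\ ~ A j g).
  by exists (pone al g) => //; rewrite !pone_supp asboolT// asboolF.
have [[g [gi gj]]|H'] := pselect (exists g, ~ A i g /\ A j g).
  exists (1 - pone al g); first by rewrite addrC -scaleN1r; exact: SL.
  rewrite !ffunE !pone_supp asboolF// asboolT//.
  by rewrite subr0 subrr.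
case/eqP: ij; apply: A_inj; apply/seteqP; split=> g Ag; apply: contrapT => NA.
  by apply: H; exists g.
by apply: H'; exists g.
Qed.

End Separated.

(** A count: pick $a_m$ in the $m$-th coset, and let $a_m^{-1}A_1$ be $A_{k(m)}$. If $A_{k(m)} =
    A_{k(m')}$, then $a_m a_{m'}^{-1}$ stabilizes $A_1$, so the cosets agree. Thus $k$ is an
    injective self-map of a finite set, hence onto. *)
Lemma stab_index_supp (H : groupClosed G) :
  stab_index H n.+1 (A ord0) ->
  injective A /\
  forall j, exists2 a, A ord0 a & ltranslate a^-1%g (A ord0) = A j.
Proof.
move=> [stabE /card_set_bijP[f [_ _ fsurj]]].
have /choice[a aP] : forall m : 'I_n.+1, exists a, A ord0 a /\
    f [set (h * a)%g | h in [set` H]] = m.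
  by move=> m; have [_ [a Aa <-] fa] := fsurj m (ltn_ord m); exists a.
have /choice[k kP] : forall m, exists j, ltranslate (a m)^-1%g (A ord0) = A j.
  move=> m; have [|j _ mj] := @pact_delta (a m)^-1%g ord0; last by exists j.
  by rewrite invgK; case: (aP m).
have key m m' : A (k m) = A (k m') -> m = m'.
  rewrite -!kP => /ltranslateV; rewrite invgK -ltranslateM => st.
  have hH : (a m * (a m')^-1)%g \in H.
    have : stabilizer (A ord0) (a m * (a m')^-1)%g by [].
    by rewrite stabE.
  apply/val_inj; rewrite /= -(aP m).2 -(aP m').2; congr f.
  apply/seteqP; split=> _ [h /= hh <-].
    exists (h * (a m * (a m')^-1))%g; first exact: gpredM.
    by rewrite -mulgA mulgVK.
  exists (h * (a m * (a m')^-1)^-1)%g; first by rewrite /= gpredM// gpredV.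
  by rewrite invgM invgK -!mulgA mulVg mulg1.
have k_inj : injective k by move=> m m' mm; apply: key; rewrite mm.
have k_onto j : exists m, k m = j.
  by have /(_ j)/codomP[m ->] := injF_onto k_inj; exists m.
split=> [j j'|j].
  have [m <-] := k_onto j; have [m' <-] := k_onto j'.
  by move=> /key ->.
have [m <-] := k_onto j; exists (a m); last exact: kP.
by case: (aP m).
Qed.

(** The translates are enumerated by the $A_i(\alpha)$ themselves, so that matrix positions and
    coordinates of $K^n$ share their indices. *)
Lemma ex_elem_data (H : groupClosed G) :
  stab_index H n.+1 (A ord0) -> exists E : elem_data H n, ed_obj E = A.
Proof.
move=> stA; have [A_inj A_onto] := stab_index_supp stA.
have /choice[r rE] : forall i, exists g, ltranslate g (A ord0) = A i.
  by move=> i; have [a _ aE] := A_onto i; exists a^-1%g.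
have objE : range A = [set ltranslate g (A ord0) | g in [set g | A ord0 g^-1%g]].
  apply/seteqP; split=> [_ [i _ <-]|_ [g Ag <-]].
    by have [a Aa aE] := A_onto i; exists a^-1%g; rewrite //= invgK.
  by have [j _ ->] := pact_delta Ag; exists j.
by exists (ElemData (supp1 ord0) stA erefl A_inj objE rE).
Qed.

End KnAction.

(** * From the skew group ring to matrices *)

Section ElemData.
Variables (G : groupType) (H : groupClosed G) (n : nat) (E : elem_data H n).
Local Notation A := (ed_obj E).
Local Notation r := (ed_rep E).
Implicit Types (g : G) (i j : 'I_n.+1).

Lemma ed_obj_translate j : exists2 b, ed_set E b^-1%g & ltranslate b (ed_set E) = A j.
Proof.
have : range A (A j) by exists j.
by rewrite ed_objE => -[b /= bA bE]; exists b.
Qed.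

Lemma ed_obj1 i : A i 1%g.
Proof.
have [b bA <-] := ed_obj_translate i.
by apply/ltranslateP; rewrite mulg1.
Qed.

Lemma ed_mor_tgt g i j : ltranslate g (A i) = A j -> A j g.
Proof. by move=> <-; apply/ltranslateP; rewrite mulVg; exact: ed_obj1. Qed.

(** If $A_j = bA$, the source must be $g^{-1}bA$; it is an object because $g \in bA$ means
    $(g^{-1}b)^{-1} \in A$. *)
Lemma ed_mor_ex g j : A j g -> exists i, ltranslate g (A i) = A j.
Proof.
have [b bA bE] := ed_obj_translate j; rewrite -bE => /ltranslateP Abg.
have : range A (ltranslate (g^-1 * b)%g (ed_set E)).
  by rewrite ed_objE; exists (g^-1 * b)%g; rewrite //= invgM invgK.
by move=> [i _ iE]; exists i; rewrite iE -ltranslateM mulVKg.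
Qed.

(** As $A_i = g_iA$, the left side says that $g_j^{-1} g g_i$ stabilizes $A$. This keeps [gpd_tau1]
    off its default value. *)
Lemma ed_morP g i j : ltranslate g (A i) = A j <-> ((r j)^-1 * g * r i)%g \in H.
Proof.
have -> : (((r j)^-1 * g * r i)%g \in H) = [set` H] ((r j)^-1 * g * r i)%g :> Prop by [].
have [<- _] := ed_stab E; rewrite /stabilizer /= -!ed_repE.
rewrite -ltranslateM.
split=> [gE|/(congr1 (ltranslate (r j)))].
  by rewrite -mulgA ltranslateM gE -ltranslateM mulVg ltranslate1.
by rewrite -ltranslateM -mulgA mulVKg.
Qed.

End ElemData.

Section MatrixIso.
Variables (K : fieldType) (G : groupType) (H : groupClosed G) (n : nat).
Variables (E : elem_data H n) (al : partial_action G (Kn K n)).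
Hypothesis suppE : ed_obj E = supp_at al.
Local Notation A := (ed_obj E).
Local Notation r := (ed_rep E).
Local Notation sH := (subgrp H).
Local Notation KH := (group_alg K sH).
Local Notation S := (skew_ring (Kn_unital al)).
Implicit Types (g : G) (i j : 'I_n.+1) (h : sH).

(** The group component of the morphism $A_i \to A_j$ that $\tau$ sends to $e_{j,i}(h)$. *)
Definition mor_at j i h : G := (r j * val h * (r i)^-1)%g.

Lemma mor_atE j i h : ltranslate (mor_at j i h) (A i) = A j.
Proof. by apply/ed_morP; rewrite /mor_at -!mulgA mulKg mulVg mulg1; exact: valP. Qed.

Lemma mor_at_inj j i : injective (mor_at j i).
Proof. by move=> h h' /mulIg/mulgI/val_inj. Qed.

Lemma mor_at_ex g i j : ltranslate g (A i) = A j -> exists h, mor_at j i h = g.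
Proof.
move=> /ed_morP gH; exists (SubGrp gH).
by rewrite /mor_at /= !mulgA mulgV mul1g mulgK.
Qed.

Lemma skew_entry_pred (x : S) j i :
  (fun h => skew_val x (mor_at j i h) j) \in skew_pred (triv_pact K sH).
Proof.
apply/skew_predP; split=> //; have /skew_predP[fin _] := valP x.
apply: sub_finite_set (finite_preimage (in2W (@mor_at_inj j i)) fin).
by move=> h /=; apply: contraNN => /eqP ->; rewrite ffunE.
Qed.

(* The coefficient of e_j delta_g becomes that of e_(j,i)(g_j^-1 g g_i), where
   g A_i = A_j. *)
Definition mx_of_skew (x : S) : mx_alg KH n :=
  \matrix_(j, i) SkewRing (triv_unital K (H := sH)) (skew_entry_pred x j i).

Lemma mx_of_skewE x j i h :
  skew_val (mx_of_skew x j i) h = skew_val x (mor_at j i h) j.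
Proof. by rewrite mxE. Qed.

Lemma mx_algP (M N : mx_alg KH n) :
  (forall j i h, skew_val (M j i) h = skew_val (N j i) h) -> M = N.
Proof. by move=> MN; apply/matrixP => j i; apply/val_inj/funext => h; exact: MN. Qed.

Lemma skew_val_supp (x : S) g j : ~ A j g -> skew_val x g j = 0.
Proof.
have /pdom_supp Dx := skew_dom g (valP x); rewrite suppE => gj.
by apply/eqP; apply: contrapT => /negP/Dx.
Qed.

(** At most one $i$ satisfies $gA_i = A_j$. Writing the coefficient as a sum over $i$ anticipates
    the middle index of a matrix product. *)
Lemma skew_coef_mul (x y : S) g k j :
  pact al g (pact al g^-1%g (skew_val x g) * skew_val y (g^-1 * k)%g) j
  = \sum_i if `[< ltranslate g (A i) = A j >]
           then skew_val x g j * skew_val y (g^-1 * k)%g i else 0.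
Proof.
have A_inj : injective (supp_at al) by rewrite -suppE; exact: ed_obj_inj.
have Dx := skew_dom g (valP x).
have Dxy : pdom al g^-1%g (pact al g^-1%g (skew_val x g) * skew_val y (g^-1 * k)%g).
  by apply: pdomMr; exact: pact_domV.
have [gj|gj] := pselect (A j g); last first.
  rewrite pact_supp0 -?suppE//; rewrite big1// => i _.
  by case: asboolP => // /ed_mor_tgt.
have [i gij] := ed_mor_ex gj; rewrite (bigD1 i)//= asboolT// big1 => [|i' ii'].
  rewrite addr0 (pact_coord A_inj (i := i)) -?suppE//.
  rewrite ffunE (pact_coord A_inj (i := j)) -?suppE ?invgK//.
  by move: gij => /ltranslateV.
case: asboolP => // gi'j; case/eqP: ii'; apply: (@ed_obj_inj _ _ _ E).
by move: gij gi'j => /ltranslateV <- /ltranslateV <-.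
Qed.

Lemma mx_of_skewM : {morph mx_of_skew : x y / x * y}.
Proof.
move=> x y; apply: mx_algP => j l h; rewrite mx_of_skewE.
pose k := mor_at j l h.
have [F FP] := skew_fset (valP x).
transitivity (\sum_(g <- F) \sum_i
    if `[< ltranslate g (A i) = A j >]
    then skew_val x g j * skew_val y (g^-1 * k)%g i else 0).
  rewrite /= (skew_mulE _ _ _ FP) sum_ffunE; apply: eq_bigr => g _.
  exact: skew_coef_mul.
transitivity (\sum_i skew_val (mx_of_skew x j i * mx_of_skew y i l) h); last first.
  rewrite [in RHS]mxE.
  by apply: (big_rec2 (fun a (b : KH) => a = skew_val b h)) => // i a b _ ->.
rewrite exchange_big /=; apply: eq_bigr => i _.
pose T g := skew_val x g j * skew_val y (g^-1 * k)%g i.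
transitivity (\sum_(g \in [set g | ltranslate g (A i) = A j]) T g).
  rewrite fsbig_mkcond (fsbigTE F) => [|g gF].
    apply: eq_bigr => g _; rewrite /patch.
    by rewrite -[_ \in _]/(`[< ltranslate g (A i) = A j >]).
  by rewrite /patch; case: ifP => // _; rewrite /T FP// ffunE mul0r.
(* The $g$ with $gA_i = A_j$ are the $g_j h' g_i^{-1}$, $h' \in H$, and then $g^{-1}k = g_i h'^{-1}
   h g_l^{-1}$: the sum becomes the product in $KH$. *)
rewrite (reindex_fsbig (mor_at j i) [set: sH]); last first.
  split=> [h' _|h' h'' _ _|g /= /mor_at_ex[h' h'E]]; first exact: mor_atE.
    exact: mor_at_inj.
  by exists h'.
rewrite /= /skew_mul; apply: eq_fsbigr => h' _.
rewrite /= /T !mxE /=; congr (_ * skew_val y _ i).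
by rewrite /k /mor_at !invgM !invgK !mulgA mulgVK.
Qed.

Lemma mx_of_skew_linear : linear mx_of_skew.
Proof.
move=> k x y; apply: mx_algP => j i h.
by rewrite mx_of_skewE !mxE /= !ffunE.
Qed.

(** A pair $(g, j)$ with $g \in A_j$ is a morphism ending at $A_j$, so it comes from exactly one
    triple $(j, i, h)$; reading the entries back along this bijection gives the inverse. *)
Lemma mx_of_skew_bij : bijective mx_of_skew.
Proof.
have /choice[src srcE] : forall gj : G * 'I_n.+1, exists i,
    A gj.2 gj.1 -> ltranslate gj.1 (A i) = A gj.2.
  move=> [g j] /=; have [/ed_mor_ex[i]|gj] := pselect (A j g); first by exists i.
  by exists ord0.
(* For $g \notin A_j$ the values of [src] and [hel] are arbitrary: [f] puts 0 there. *)
pose hel g j : sH := insubd 1%g ((r j)^-1 * g * r (src (g, j)))%g.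
have helE g j : A j g -> mor_at j (src (g, j)) (hel g j) = g.
  move=> gj; have /ed_morP gH := srcE (g, j) gj.
  by rewrite /mor_at insubdK// !mulgA mulgV mul1g mulgK.
have srcP j i h : src (mor_at j i h, j) = i.
  have := srcE (_, j) (ed_mor_tgt (mor_atE j i h)) => /= /ltranslateV sE.
  apply: (@ed_obj_inj _ _ _ E); rewrite -sE.
  by have /ltranslateV := mor_atE j i h.
pose f (M : mx_alg KH n) g : Kn K n :=
  [ffun j => if `[< A j g >] then skew_val (M j (src (g, j))) (hel g j) else 0].
have fP M : f M \in skew_pred al.
  apply/skew_predP; split=> [|g]; last first.
    apply/pdom_supp => i; rewrite ffunE -suppE; case: asboolP => //.
    by rewrite eqxx.
  (* The support of [f M] lies in the union, over the finitely many positions, of the images of the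
     supports of the entries. *)
  pose X (ji : 'I_n.+1 * 'I_n.+1) :=
    [set mor_at ji.1 ji.2 h | h in [set h | skew_val (M ji.1 ji.2) h != 0]].
  have Xfin : finite_set (\bigcup_(ji in setT) X ji).
    apply: bigcup_finite => // ji _; apply: finite_image.
    by have /skew_predP[] := valP (M ji.1 ji.2).
  apply: sub_finite_set Xfin => g /= /eqP fg; apply: contrapT => gX; apply: fg.
  apply/ffunP => j; rewrite !ffunE; case: asboolP => // gj.
  apply/eqP; apply: contrapT => /negP Mg; apply: gX.
  exists (j, src (g, j)) => //; exists (hel g j) => //=.
  exact: helE.
exists (fun M => SkewRing (Kn_unital al) (fP M)) => [x|M].
  apply/val_inj/funext => g; apply/ffunP => j; rewrite ffunE.
  by case: asboolP => [gj|/skew_val_supp->//]; rewrite mx_of_skewE helE.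
apply: mx_algP => j i h; rewrite mx_of_skewE /= ffunE.
have gj := ed_mor_tgt (mor_atE j i h); rewrite asboolT// srcP.
congr (skew_val _ _); apply: (@mor_at_inj j i).
by have := helE _ _ gj; rewrite srcP.
Qed.

(** In position $(j,i)$ both sides have coefficient 1 at $h$ if $g_j h g_i^{-1} = g$ and 0
    otherwise: on the left by the support of $1_g$, on the right because at most one morphism $A_i
    \to A_j$ has component $g$. *)
Lemma mx_of_skew_pi g :
  mx_of_skew (pi_fun (Kn_unital al) g) = gpd_tau (gpd_lambda K E g).
Proof.
(* A morphism with component $g$ is determined by its two ends. *)
have fin : finite_set [set m : gpd_mor E | mor_elt m == g].
  pose B := [set (ij.1, g, ij.2) | ij in [set: 'I_n.+1 * 'I_n.+1]].
  have Bfin : finite_set B by exact: finite_image.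
  apply: sub_finite_set (finite_preimage (in2W val_inj) Bfin) => m /= /eqP mg.
  by exists (mor_src m, mor_tgt m) => //=; rewrite -mg; case: m {mg} => -[[]].
pose F := fset_set [set m : gpd_mor E | mor_elt m == g].
have FP m : m \notin F -> gpd_lambda K E g m = 0.
  by rewrite in_fset_set// notin_setE /= /gpd_lambda => /negP/negbTE ->.
rewrite /gpd_tau (fsbigTE F); last by move=> m /FP ->; rewrite scale0r.
apply: mx_algP => j i h; rewrite mx_of_skewE.
pose T m : K := gpd_lambda K E g m *
  ((j == mor_tgt m) && (i == mor_src m) &&
   (h == insubd 1%g ((r (mor_tgt m))^-1 * mor_elt m * r (mor_src m))%g))%:R.
transitivity (\sum_(m <- F) T m); last first.
  apply: (big_rec2 (fun a (b : mx_alg KH n) => a = skew_val (b j i) h)).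
    by rewrite mxE.
  move=> m a b _ ->; rewrite mxE /= addrfctE; congr (_ + _).
  rewrite !mxE /T; case: ifP => _ /=; last by rewrite mulr0 scaler0.
  by rewrite scalrfctE /skew_mono; case: ifP.
rewrite -(fsbigTE (idx := 0) (op := +%R)); last by move=> m /FP; rewrite /T => ->; rewrite mul0r.
rewrite /= /skew_mono; have [gij|gij] := pselect (ltranslate g (A i) = A j).
  pose m0 : gpd_mor E := exist _ (i, g, j) (asboolT gij).
  rewrite (fsbigTE [fset m0]%fset) => [|m]; last first.
    rewrite in_fset1 => mm0; rewrite /T /gpd_lambda.
    case: eqP => [mg|]; last by rewrite mul0r.
    case: eqP => [mj|]; last by rewrite mulr0.
    case: eqP => [mi|]; last by rewrite mulr0.
    case/eqP: mm0; apply: val_inj => /=.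
    by rewrite -mg mi mj; case: m {mg mi mj} => -[[]].
  rewrite big_seq_fset1 /T /gpd_lambda /= /mor_elt /mor_tgt /mor_src /= !eqxx mul1r /=.
  have /ed_morP gH := gij.
  have -> : (h == insubd 1%g ((r j)^-1 * g * r i)%g) = (mor_at j i h == g).
    rewrite -(inj_eq val_inj) insubdK// /mor_at.
    apply/eqP/eqP => [->|<-]; first by rewrite !mulgA mulgV mul1g mulgK.
    by rewrite !mulgA mulVg mul1g mulgVK.
  case: eqP => _; rewrite ?ffunE// pone_supp -suppE asboolT//.
  exact: ed_mor_tgt gij.
rewrite fsbig1 => [|m _].
  by case: eqP => [hg|]; rewrite ?ffunE//; case: gij; rewrite -hg mor_atE.
rewrite /T /gpd_lambda.
case: eqP => [mg|]; last by rewrite mul0r.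
case: eqP => [mj|]; last by rewrite mulr0.
case: eqP => [mi|]; last by rewrite mulr0.
case: gij; rewrite -mg mi mj; exact: (asboolW (valP m)).
Qed.

(** A surjective multiplicative map preserves the unit. *)
Lemma mx_of_skew1 : mx_of_skew 1 = 1.
Proof.
have [f mK fK] := mx_of_skew_bij.
transitivity (mx_of_skew 1 * mx_of_skew (f 1)); first by rewrite fK mulr1.
by rewrite -mx_of_skewM mul1r fK.
Qed.

Lemma ex_elementary_prep : exists phi : {lrmorphism S -> mx_alg KH n},
  bijective phi /\
  forall g, phi (pi_fun (Kn_unital al) g) = gpd_tau (gpd_lambda K E g).
Proof.
have [||| phi phiE] := @ex_lrmorphism K S (mx_alg KH n) mx_of_skew.
- exact: mx_of_skew_linear.
- exact: mx_of_skew1.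
- exact: mx_of_skewM.
exists phi; rewrite phiE; split; [exact: mx_of_skew_bij|exact: mx_of_skew_pi].
Qed.

End MatrixIso.

(** * The partial action of an elementary representation *)

Section ElementaryAction.
Variables (K : fieldType) (G : groupType) (H : groupClosed G) (n : nat).
Variable E : elem_data H n.
Local Notation A := (ed_obj E).
Local Notation V := (Kn K n).
Implicit Types (x y : V) (g h : G) (i j : 'I_n.+1).

Definition elem_dom g : set V := [set x | forall i, x i != 0 -> A i g].

(** By injectivity of [ed_obj] the [pick] has at most one candidate; it has none exactly when $g
    \notin A_j$, so all values lie in $D_g$. *)
Definition elem_act g x : V :=
  [ffun j => if [pick i | `[< ltranslate g (A i) = A j >]] is Some i
             then x i else 0].

Lemma elem_actE g i j x : ltranslate g (A i) = A j -> elem_act g x j = x i.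
Proof.
move=> gij; rewrite ffunE; case: pickP => [i' /asboolP gi'j|/(_ i)]; last first.
  by rewrite asboolT.
congr (x _); apply: (@ed_obj_inj _ _ _ E).
by move: gij gi'j => /ltranslateV <- /ltranslateV <-.
Qed.

Lemma elem_act0 g j x : ~ A j g -> elem_act g x j = 0.
Proof.
by move=> gj; rewrite ffunE; case: pickP => // i /asboolP/ed_mor_tgt.
Qed.

Lemma elem_dom0 g i x : elem_dom g x -> ~ A i g -> x i = 0.
Proof. by move=> Dx gi; apply/eqP; apply: contrapT => /negP/Dx. Qed.

Lemma elem_act_dom g x : elem_dom g (elem_act g x).
Proof.
by move=> j; have [//|/(@elem_act0 _ _ x) ->] := pselect (A j g); rewrite eqxx.
Qed.

Lemma elem_act_comp g h x :
  elem_dom h^-1%g x -> elem_dom g^-1%g (elem_act h x) ->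
  elem_act g (elem_act h x) = elem_act (g * h)%g x.
Proof.
move=> Dx Dhx; apply/ffunP => j.
have [gj|gj] := pselect (A j g).
  have [i gij] := ed_mor_ex gj; rewrite (elem_actE _ gij).
  have [hi|hi] := pselect (A i h).
    have [l hli] := ed_mor_ex hi; rewrite (elem_actE _ hli).
    by rewrite (elem_actE (i := l))// ltranslateM hli.
  rewrite elem_act0//.
  have [/ed_mor_ex[l]|/elem_act0-> //] := pselect (A j (g * h)%g).
  rewrite ltranslateM => glj; case: hi; apply: (@ed_mor_tgt _ _ _ _ _ l).
  by move: gij glj => /ltranslateV <- /ltranslateV.
rewrite elem_act0//.
(* Here $g \notin A_j$, and $x_l = 0$ is needed when $ghA_l = A_j$. If $h^{-1} \notin A_l$ this is
   the support of $x$; otherwise $hA_l = A_i$ for some $i$, and $gA_i = A_j$ would put $g$ in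
   $A_j$. *)
have [/ed_mor_ex[l glj]|/elem_act0-> //] := pselect (A j (g * h)%g).
rewrite (elem_actE _ glj).
have [hl|/(elem_dom0 Dx)//] := pselect (A l h^-1%g).
have [i /ltranslateV] := ed_mor_ex hl; rewrite invgK => hli.
rewrite -(elem_actE _ hli); apply/esym/(elem_dom0 Dhx) => gi; apply: gj.
by apply: (@ed_mor_tgt _ _ _ _ _ i); rewrite -hli -ltranslateM.
Qed.

Lemma elem_act1 x : elem_act 1%g x = x.
Proof. by apply/ffunP => j; apply: elem_actE; rewrite ltranslate1. Qed.

Lemma elem_dom1 : elem_dom 1%g = [set: V].
Proof. by apply/seteqP; split=> // x _ i _; exact: ed_obj1. Qed.

Lemma elem_actK g x : elem_dom g^-1%g x -> elem_act g^-1%g (elem_act g x) = x.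
Proof.
move=> Dx; rewrite elem_act_comp ?invgK ?mulVg ?elem_act1//.
exact: elem_act_dom.
Qed.

Lemma elem_dom_ideal g : two_sided_ideal (elem_dom g).
Proof.
split=> [i|k x y Dx Dy i|a x Dx]; first by rewrite ffunE eqxx.
  rewrite !ffunE => xy; apply: contrapT => gi; case/eqP: xy.
  by rewrite (elem_dom0 Dx gi) (elem_dom0 Dy gi) mulr0 addr0.
split=> i; rewrite ffunE => ax; apply: contrapT => gi; case/eqP: ax.
  by rewrite (elem_dom0 Dx gi) mulr0.
by rewrite (elem_dom0 Dx gi) mul0r.
Qed.

Lemma elem_act_iso g : alg_iso_on (elem_dom g^-1%g) (elem_dom g) (elem_act g).
Proof.
split.
- split=> [x _|x y|y Dy]; first exact: elem_act_dom.
    rewrite !inE => /elem_actK xE /elem_actK yE xy.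
    by rewrite -xE xy yE.
  exists (elem_act g^-1%g y); first exact: elem_act_dom.
  by rewrite -{1}[g]invgK elem_actK// invgK.
- move=> k x y _ _; apply/ffunP => j; rewrite !ffunE.
  by case: pickP => *; rewrite ?ffunE// mulr0 addr0.
- move=> x y _ _; apply/ffunP => j; rewrite !ffunE.
  by case: pickP => *; rewrite ?ffunE// mulr0.
Qed.

Lemma elem_dom_comp g h :
  elem_dom h^-1%g `&` elem_act h @^-1` (elem_dom h `&` elem_dom g^-1%g)
  `<=` elem_dom (g * h)^-1%g.
Proof.
move=> x [Dx [_ Dhx]] i xi.
have [j /ltranslateV] := ed_mor_ex (Dx i xi); rewrite invgK => hij.
have : A j g^-1%g by apply: Dhx; rewrite (elem_actE _ hij).
by rewrite -hij => /ltranslateP; rewrite invgM.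
Qed.

Definition elem_pact : partial_action G V.
Proof.
apply: (PartialAction elem_dom_ideal elem_act_iso elem_dom1 elem_act1 elem_dom_comp).
by move=> g h x [Dx [_ Dhx]]; exact: elem_act_comp.
Defined.

Lemma elem_pact_supp : supp_at elem_pact = A.
Proof.
apply/funext => i; apply/seteqP; split=> g.
  exact: (pone_dom (Kn_unital elem_pact)).
move=> gi; apply/pdom_delta => j; rewrite ffunE.
by case: (eqVneq j i) => [->//|_]; rewrite eqxx.
Qed.

End ElementaryAction.

(** * The correspondence between equivalence classes *)

Section Correspondence.
Variables (K : fieldType) (G : groupType) (H : groupClosed G) (n : nat).

Lemma prep_of_pact_elementary (al : partial_action G (Kn K n)) :
  stab_index H n.+1 (supp_at al ord0) ->
  exists2 p : partial_rep G (mx_alg (group_alg K (subgrp H)) n),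
    elementary p & prep_equiv (prep_of_pact (Kn_unital al)) p.
Proof.
move=> /ex_elem_data[E EE]; have [phi [phib phiE]] := ex_elementary_prep EE.
exists (prep_map phi (prep_of_pact (Kn_unital al))); first by exists E => g /=.
by apply: prep_equiv_sym; exists phi.
Qed.

Lemma pact_of_prep_elementary
    (p : partial_rep G (mx_alg (group_alg K (subgrp H)) n)) :
  elementary p ->
  exists2 al : partial_action G (Kn K n), stab_index H n.+1 (supp_at al ord0) &
    prep_equiv p (prep_of_pact (Kn_unital al)).
Proof.
move=> [E pE]; exists (elem_pact K E).
  by rewrite elem_pact_supp ed_obj0; exact: ed_stab.
have [phi [phib phiE]] := ex_elementary_prep (esym (elem_pact_supp K E)).
by exists phi => // g; rewrite pE -phiE.
Qed.

Lemma pact_of_prep_of_Kn_pact (al : partial_action G (Kn K n)) :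
  stab_index H n.+1 (supp_at al ord0) ->
  pact_equiv (pact_of_prep (prep_of_pact (Kn_unital al))) al.
Proof.
move=> /stab_index_supp[A_inj _]; apply: pact_of_prep_of_pact.
exact: pone_generated.
Qed.

End Correspondence.

Theorem theorem6p11 (K : fieldType) (G : groupType) (n : nat)
    (H : groupClosed G) :
  exists (Phi : (any_prep K G -> Prop) -> (any_pact K G -> Prop))
         (Psi : (any_pact K G -> Prop) -> (any_prep K G -> Prop)),
    (* Phi is the map induced by pi |-> alpha^pi *)
    (forall C, elementary_class H n C ->
      Kn_pact_class H n (Phi C) /\
      forall p : any_prep K G, C p -> Phi C = pact_class (pact_of_prep p)) /\
    (* Psi is the map induced by alpha |-> pi_alpha *)
    (forall D, Kn_pact_class H n D ->
      elementary_class H n (Psi D) /\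
      forall al : any_pact K G, D al -> forall u : unital_pact al,
        Psi D = prep_class (prep_of_pact u)) /\
    (* Phi and Psi are mutually inverse *)
    (forall C, elementary_class H n C -> Psi (Phi C) = C) /\
    (forall D, Kn_pact_class H n D -> Phi (Psi D) = D).
Proof.
(* Both maps are defined on arbitrary predicates, as the union of the classes of the images of all
   members. *)
pose Phi (C : any_prep K G -> Prop) : any_pact K G -> Prop :=
  fun be => exists2 p : any_prep K G, C p & pact_class (pact_of_prep p) be.
pose Psi (D : any_pact K G -> Prop) : any_prep K G -> Prop :=
  fun q => exists2 al : any_pact K G, D al &
    exists u : unital_pact al, prep_class (prep_of_pact u) q.
(* On an equivalence class the union collapses to a single class, since the construction preserves
   equivalence. *)
have PhiE (B : algType K) (p : partial_rep G B) :
    Phi (prep_class p) = pact_class (pact_of_prep p).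
  apply/funext => be; apply/propext; split=> [[q qp]|].
    by rewrite (pact_class_eq (pact_of_prep_equiv qp)).
  by exists (AnyPrep p); first exact: (prep_class_refl (AnyPrep p)).
have PsiE (A : algType K) (al : partial_action G A) (u : unital_pact al) :
    Psi (pact_class al) = prep_class (prep_of_pact u).
  apply/funext => q; apply/propext; split=> [[be beal [v]]|qu].
    by rewrite (prep_class_eq (prep_of_pact_equiv v u beal)).
  by exists (AnyPact al); [exact: (pact_class_refl (AnyPact al)) | exists u].
exists Phi, Psi; split=> [C [p pel ->]|].
  split; last by move=> q qp; rewrite PhiE (pact_class_eq (pact_of_prep_equiv qp)).
  have [al alst pal] := pact_of_prep_elementary pel; exists al => //.
  rewrite PhiE; apply: pact_class_eq.
  (* From $p \sim \pi_\alpha$ follows $\alpha^p \sim \alpha^{\pi_\alpha} \sim \alpha$. *)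
  apply: pact_equiv_trans (pact_of_prep_equiv pal) _.
  exact: pact_of_prep_of_Kn_pact alst.
split=> [D [al alst ->]|].
  split.
    have [p pel alp] := prep_of_pact_elementary alst; exists p => //.
    by rewrite (PsiE _ _ (Kn_unital al)); exact: prep_class_eq.
  move=> be beal v; rewrite (PsiE _ _ (Kn_unital al)); apply: prep_class_eq.
  exact/prep_of_pact_equiv/pact_equiv_sym.
split=> [C [p pel ->]|D [al alst ->]].
  have [al alst pal] := pact_of_prep_elementary pel.
  rewrite PhiE (pact_class_eq (pact_of_prep_equiv pal)).
  rewrite (pact_class_eq (pact_of_prep_of_Kn_pact alst)) (PsiE _ _ (Kn_unital al)).
  by rewrite (prep_class_eq pal).
rewrite (PsiE _ _ (Kn_unital al)) PhiE; apply: pact_class_eq.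
exact: pact_of_prep_of_Kn_pact alst.
Qed.
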